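(* Let $G$ be an undirected connected finite graph without loops (parallel edges allowed). If $G$ has stable gonality $k$, then $G$ has treewidth at most $k$. Moreover, given a refinement $G'$ of $G$, a tree $T$, and a finite harmonic morphism $f:G'\to T$ of degree $k$, a tree decomposition of $G$ of width at most $k$ can be constructed in $O(k^2|V(G')|)$ time.
   Context: Graphs are finite, may have parallel edges but no loops. A graph homomorphism $f:G\to H$ maps vertices to vertices and edges to edges such that an edge between $u$ and $v$ is mapped to an edge between $f(u)$ and $f(v)$. A finite morphism is such a homomorphism together with an index function $r_f:E(G)\to\mathbb{Z}_{>0}$. It is harmonic if for every $v\in V(G)$ there is a constant $m_f(v)$ such that for every edge $e\in E(H)$ incident to $f(v)$, $\sum_{e'\text{ incident to }v,\ f(e')=e} r_f(e')=m_f(v)$. If $H$ is connected and $|E(G)|\geq 1$, there is a positive integer $\deg(f)$ (the degree) with $\deg(f)=\sum_{v: f(v)=w}m_f(v)=\sum_{e': f(e')=e}r_f(e')$ for all $w\in V(H)$, $e\in E(H)$. A refinement of $G$ is a graph obtained from $G$ by zero or more operations of subdividing an edge or adding a new vertex joined by one edge to an existing vertex. The stable gonality of a connected nonempty graph $G$ is the minimum degree of a finite harmonic morphism from a refinement of $G$ to a tree. A tree decomposition of $G$ is a pair $(T,(X_i)_{i\in I})$ with $T=(I,F)$ a tree and $X_i\subseteq V(G)$, such that $\bigcup_i X_i=V(G)$, every edge has both ends in some $X_i$, and for each vertex $v$ the set $\{i: v\in X_i\}$ induces a connected subtree; its width is $\max_i|X_i|-1$, and the treewidth of $G$ is the minimum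 width of a tree decomposition. *)

(* Defs.v *)
From mathcomp Require Import all_boot.

Set Implicit Arguments.
Unset Strict Implicit.
Unset Printing Implicit Defensive.

(* Finite undirected graphs, parallel edges allowed, no loops: every edge has
   a two-element set of ends. *)
Record mgraph := MGraph {
  vertex : finType;
  edge : finType;
  ends : edge -> {set vertex};
  card_ends : forall e, #|ends e| = 2
}.

Arguments ends {m} e.

Section Graphs.
Variable G : mgraph.

Definition adj : rel (vertex G) := [rel x y | [exists e, ends e == [set x; y]]].

Definition connected : Prop :=
  0 < #|vertex G| /\ forall x y : vertex G, connect adj x y.

Definition induces_connected (S : {set vertex G}) : Prop :=
  S != set0 /\
  {in S &, forall x y,
    connect [rel a b | [&& a \in S, b \in S & adj a b]] x y}.

(* A walk from x is the list of its successive (edge, next vertex) steps. *)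
Fixpoint walk (x : vertex G) (p : seq (edge G * vertex G)) : bool :=
  if p is (e, y) :: q then (ends e == [set x; y]) && walk y q else true.

(* Two parallel edges form a cycle of length 2. *)
Definition cycle_at (x : vertex G) (p : seq (edge G * vertex G)) : bool :=
  [&& p != [::], walk x p, last x (unzip2 p) == x,
      uniq (unzip1 p) & uniq (unzip2 p)].

Definition is_tree : Prop := connected /\ forall x p, ~~ cycle_at x p.

End Graphs.

Section Refinement.
Variable G : mgraph.

Section Subdivide.
Variable e : edge G.

(* The edge e is replaced by one edge from each of its two ends to the new
   vertex None. *)
Definition subdivide_ends
    (d : {d : edge G | d != e} + {x : vertex G | x \in ends e}) :
    {set option (vertex G)} :=
  match d with
  | inl d => Some @: ends (val d)
  | inr x => [set Some (val x); None]
  end.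

Lemma card_subdivide_ends d : #|subdivide_ends d| = 2.
Proof.
case: d => [d | x] /=; last by rewrite cards2.
by rewrite card_imset ?card_ends //; apply: Some_inj.
Qed.

Definition subdivide : mgraph := MGraph card_subdivide_ends.

End Subdivide.

Section AddLeaf.
Variable v : vertex G.

Definition add_leaf_ends (d : option (edge G)) : {set option (vertex G)} :=
  if d is Some d then Some @: ends d else [set Some v; None].

Lemma card_add_leaf_ends d : #|add_leaf_ends d| = 2.
Proof.
case: d => [d |] /=; last by rewrite cards2.
by rewrite card_imset ?card_ends //; apply: Some_inj.
Qed.

Definition add_leaf : mgraph := MGraph card_add_leaf_ends.

End AddLeaf.
End Refinement.

(* [refinement phi] says that G' is (up to isomorphism) a refinement of G, where
   phi sends each vertex of G to the same vertex seen in G'. *)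
Inductive refinement (G : mgraph) :
    forall G' : mgraph, (vertex G -> vertex G') -> Prop :=
| refinement_id : @refinement G G id
| refinement_iso (G1 G2 : mgraph) (phi : vertex G -> vertex G1)
    (g : vertex G1 -> vertex G2) (h : edge G1 -> edge G2) :
    refinement phi -> bijective g -> bijective h ->
    (forall e, ends (h e) = g @: ends e) ->
    @refinement G G2 (g \o phi)
| refinement_subdivide (G1 : mgraph) (phi : vertex G -> vertex G1)
    (e : edge G1) :
    refinement phi -> @refinement G (subdivide e) (Some \o phi)
| refinement_add_leaf (G1 : mgraph) (phi : vertex G -> vertex G1)
    (v : vertex G1) :
    refinement phi -> @refinement G (add_leaf v) (Some \o phi).

Record finite_morphism (G H : mgraph) := FiniteMorphism {
  fV : vertex G -> vertex H;
  fE : edge G -> edge H;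
  edge_index : edge G -> nat;
  ends_fE : forall e, ends (fE e) = fV @: ends e;
  edge_index_gt0 : forall e, 0 < edge_index e
}.

Section Harmonic.
Variables (G H : mgraph) (f : finite_morphism G H).

Definition harmonic_with (m : vertex G -> nat) : Prop :=
  forall (v : vertex G) (e : edge H), fV f v \in ends e ->
    \sum_(e' : edge G | (v \in ends e') && (fE f e' == e)) edge_index f e' = m v.

(* The degree is only defined when G has an edge. *)
Definition harmonic_of_degree (k : nat) : Prop :=
  0 < #|edge G| /\
  exists m : vertex G -> nat,
    [/\ harmonic_with m,
        forall w : vertex H, \sum_(v : vertex G | fV f v == w) m v = k &
        forall e : edge H, \sum_(e' : edge G | fE f e' == e) edge_index f e' = k].

End Harmonic.

(* k is the degree of a finite harmonic morphism from a refinement of G to a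
   tree. *)
Definition refinement_tree_degree (G : mgraph) (k : nat) : Prop :=
  exists (G' T : mgraph) (phi : vertex G -> vertex G')
    (f : finite_morphism G' T),
    [/\ refinement phi, is_tree T & harmonic_of_degree f k].

Definition has_stable_gonality (G : mgraph) (k : nat) : Prop :=
  refinement_tree_degree G k /\
  forall k', refinement_tree_degree G k' -> k <= k'.

Section TreeDecomposition.
Variable G : mgraph.

Definition tree_decomposition (T : mgraph) (X : vertex T -> {set vertex G}) :
    Prop :=
  [/\ is_tree T,
      \bigcup_(i : vertex T) X i = [set: vertex G],
      forall e : edge G, exists i, ends e \subset X i &
      forall v : vertex G, induces_connected [set i | v \in X i]].

Definition width (T : mgraph) (X : vertex T -> {set vertex G}) : nat :=
  (\max_(i : vertex T) #|X i|).-1.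

Definition has_treewidth (w : nat) : Prop :=
  (exists (T : mgraph) (X : vertex T -> {set vertex G}),
     tree_decomposition X /\ width X = w) /\
  forall (T : mgraph) (X : vertex T -> {set vertex G}),
    tree_decomposition X -> w <= width X.

End TreeDecomposition.

(* Running time is measured on a uniform-cost random access machine over the
   natural numbers, with addition and truncated subtraction, structured control
   flow, and a store made of arrays [s a : nat -> nat].  Array names are literals,
   so a program uses finitely many arrays; on a machine with one memory they can
   be interleaved at a constant-factor cost.  A scalar variable is cell 0 of an
   array. *)
Definition store := nat -> nat -> nat.

Inductive expr :=
| Num of nat
| Get of nat & expr
| Plus of expr & expr
| Minus of expr & expr.

Fixpoint eval (s : store) (x : expr) : nat :=
  match x with
  | Num n => n
  | Get a x => s a (eval s x)
  | Plus x y => eval s x + eval s y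
  | Minus x y => eval s x - eval s y
  end.

Fixpoint cost (x : expr) : nat :=
  match x with
  | Num _ => 1
  | Get _ x => (cost x).+1
  | Plus x y | Minus x y => (cost x + cost y).+1
  end.

Definition update (s : store) (a i n : nat) : store :=
  fun b j => if (b == a) && (j == i) then n else s b j.

(* [Put a x y] is the assignment a[x] := y; tests succeed on nonzero values. *)
Inductive program :=
| Skip
| Put of nat & expr & expr
| Seq of program & program
| If of expr & program & program
| While of expr & program.

(* [exec p s s' t]: started in s, p halts in s' after t steps. *)
Inductive exec : program -> store -> store -> nat -> Prop :=
| exec_skip s : exec Skip s s 1
| exec_put a x y s :
    exec (Put a x y) s (update s a (eval s x) (eval s y))
      (cost x + cost y).+1
| exec_seq p q s s1 s2 t1 t2 :
    exec p s s1 t1 -> exec q s1 s2 t2 -> exec (Seq p q) s s2 (t1 + t2).+1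
| exec_if_true x p q s s' t :
    eval s x != 0 -> exec p s s' t -> exec (If x p q) s s' (cost x + t).+1
| exec_if_false x p q s s' t :
    eval s x = 0 -> exec q s s' t -> exec (If x p q) s s' (cost x + t).+1
| exec_while_true x p s s1 s2 t1 t2 :
    eval s x != 0 -> exec p s s1 t1 -> exec (While x p) s1 s2 t2 ->
    exec (While x p) s s2 (cost x + t1 + t2).+1
| exec_while_false x p s :
    eval s x = 0 -> exec (While x p) s s (cost x).+1.

(* Inputs and outputs are lists of lists of numbers, the a-th list being held in
   array a; all other cells are initially 0. *)
Definition load (w : seq (seq nat)) : store :=
  fun a i => nth 0 (nth [::] w a) i.

Definition holds (s : store) (w : seq (seq nat)) : Prop :=
  forall a i, i < size (nth [::] w a) -> s a i = nth 0 (nth [::] w a) i.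

(* Elements of a finite type are numbered by their rank in its enumeration.  As
   the vertex and edge types of a graph are arbitrary finite types, this is an
   arbitrary numbering. *)
Definition code (A : finType) (x : A) : nat := enum_rank x.

(* s lists the elements of S, without repetition, in any order. *)
Definition lists (A : finType) (s : seq nat) (S : {set A}) : Prop :=
  perm_eq s [seq code x | x <- enum S].

Definition code_fun (A B : finType) (g : A -> B) : seq nat :=
  [seq code (g x) | x <- enum A].

(* A graph is encoded by its numbers of vertices and edges, and the list of the
   pairs of ends of its edges. *)
Definition codes_graph (G : mgraph) (w : seq (seq nat)) : Prop :=
  exists2 s : edge G -> seq nat,
    forall e, lists (s e) (ends e) &
    w = [:: [:: #|vertex G|; #|edge G|]; flatten [seq s e | e <- enum (edge G)]].

Definition codes_instance (G G' T : mgraph) (phi : vertex G -> vertex G')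
    (f : finite_morphism G' T) (w : seq (seq nat)) : Prop :=
  exists wG wG' wT,
    [/\ codes_graph G wG, codes_graph G' wG', codes_graph T wT &
        w = wG ++ wG' ++ wT ++
            [:: code_fun phi; code_fun (fV f); code_fun (fE f);
                [seq edge_index f e | e <- enum (edge G')]]].

(* The bags are concatenated, each one preceded by its size. *)
Definition codes_tree_decomposition (G T : mgraph)
    (X : vertex T -> {set vertex G}) (w : seq (seq nat)) : Prop :=
  exists (wT : seq (seq nat)) (s : vertex T -> seq nat),
    [/\ codes_graph T wT, forall i, lists (s i) (X i) &
        w = wT ++
            [:: flatten [seq size (s i) :: s i | i <- enum (vertex T)]]].

(* Main.v *)
From Stdlib Require Import Classical_Prop.
From mathcomp Require Import all_boot zify.
Require Import Defs.

Set Implicit Arguments.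
Unset Strict Implicit.
Unset Printing Implicit Defensive.

(** Contract the refinement G' onto G: grow the vertices phi(v) simultaneously into a
    partition of V(G') into connected classes.  Whatever the order of growth, every
    edge of G is still represented by an edge of G' between the two classes, because
    a subdivision vertex or a hanging tree only ever reaches the ends of its own edge.

    Subdivide the edge uv of T by the edges x1, ..., xj of G' above it, with ends
    a1, ..., aj above u and b1, ..., bj above v, and take the bags
    {ai, ..., aj, b1, ..., bi} at xi and the fiber of w at each vertex w of T.
    Indices are positive, so fibers have at most k elements and bags at most k + 1;
    replacing vertices of G' by their classes gives the decomposition of G.

    A tree has fewer edges than vertices and T has at most |V(G')| vertices, so G' has
    at most k |V(G')| edges; the search and the at most (k + 1) |V(G')| bags, each
    written in time O(k), fit in time O(k^2 |V(G')|).  The bound on the treewidth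
    follows by running the program on an arbitrary encoding of a morphism. *)

(** * Timed execution of programs *)

(** Along the path over uv the bags trade the ends above u for the ends above v, one edge at a time.
    At xi both ai and bi are present: this covers the edge xi of G' and costs the one element beyond
    the size of a fiber. The order of the edges along the path is immaterial, so their given
    numbering is used. Linked lists filled by head insertion store that order backwards, so the
    neighbours on a path are read off the lists and nothing is sorted.

    The operations that produced G' are not part of the input, only phi is. Search and decomposition
    therefore meet in a narrow interface: labels that are correct on every phi(v) and have connected
    classes. That such labels represent every edge of G is proved by induction on the refinement,
    for all of them at once.

    Several vertices of a bag may carry the same label. Stamping each label with the number of the
    bag detects this in constant time, so that a bag costs time proportional to its list and not to
    |V(G)|.

    Acyclicity is handled by cuts: an edge is certified as a bridge by a two-colouring of the
    vertices, and such certificates pass easily from T to its subdivision. *)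

Fixpoint mods (p : program) : seq nat :=
  match p with
  | Skip => [::]
  | Put a _ _ => [:: a]
  | Seq p q | If _ p q => mods p ++ mods q
  | While _ p => mods p
  end.

Lemma exec_frame p s s' t :
  exec p s s' t -> forall a, a \notin mods p -> s' a = s a.
Proof.
elim=> //= {p s s' t}.
- by move=> a x y s b; rewrite inE /update => /negbTE ->.
- by move=> p q s s1 s2 t1 t2 _ IH1 _ IH2 a; rewrite mem_cat negb_or => /andP[? ?];
    rewrite IH2 ?IH1.
- by move=> x p q s s' t _ _ IH a; rewrite mem_cat negb_or => /andP[? ?]; rewrite IH.
- by move=> x p q s s' t _ _ IH a; rewrite mem_cat negb_or => /andP[? ?]; rewrite IH.
- by move=> x p s s1 s2 t1 t2 _ _ IH1 _ IH2 a ?; rewrite IH2 ?IH1.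
Qed.

(** A total-correctness triple with a time budget, attached to one initial store so that [runs_seq]
    can nest a second triple in the postcondition of the first. *)
Definition runs (p : program) (s : store) (T : nat) (Q : store -> Prop) : Prop :=
  exists s' t, [/\ exec p s s' t, t <= T & Q s'].

Definition same_outside (l : seq nat) (s s' : store) : Prop :=
  forall a, a \notin l -> s' a = s a.

Lemma runs_frame p s T Q :
  runs p s T Q -> runs p s T (fun s' => Q s' /\ same_outside (mods p) s s').
Proof.
by case=> s' [t [e le q]]; exists s', t; split=> //; split=> //; apply: exec_frame e.
Qed.

Lemma runs_weaken p s T T' (Q Q' : store -> Prop) :
  runs p s T Q -> T <= T' ->
  (forall s', same_outside (mods p) s s' -> Q s' -> Q' s') -> runs p s T' Q'.
Proof.
move=> /runs_frame[s' [t [e le [q fr]]]] le' QQ'; exists s', t; split=> //.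
  exact: leq_trans le le'.
exact: QQ'.
Qed.

Lemma runs_seq p q s T1 T2 T Q :
  runs p s T1 (fun s1 => runs q s1 T2 Q) -> (T1 + T2).+1 <= T ->
  runs (Seq p q) s T Q.
Proof.
case=> s1 [t1 [e1 le1 [s2 [t2 [e2 le2 q2]]]]] le.
exists s2, (t1 + t2).+1; split=> //; last by lia.
exact: exec_seq e1 e2.
Qed.

(** The invariant carries the remaining budget [b], which drops at every test: a single induction
    gives termination and the time bound, amortised costs included. *)
Lemma runs_while (I : nat -> store -> Prop) x p Q :
  (forall b s, I b s ->
     if eval s x == 0 then cost x < b /\ Q s
     else exists c b', c + b' + cost x < b /\ runs p s c (I b')) ->
  forall b s, I b s -> runs (While x p) s b Q.
Proof.
move=> step b; have [B] := ubnP b; elim: B b => // B IH b ltb s Ibs.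
have := step b s Ibs; case: eqP => [x0 [lt q]|/eqP x0 [c [b' [lt]]]].
  by exists s, (cost x).+1; split=> //; apply: exec_while_false.
case=> s1 [t1 [e1 le1 I1]].
have [|s2 [t2 [e2 le2 q2]]] := IH b' _ s1 I1; first by lia.
exists s2, (cost x + t1 + t2).+1; split=> //; last by lia.
exact: exec_while_true e1 e2.
Qed.

Fixpoint loopfree (p : program) : bool :=
  match p with
  | Skip | Put _ _ _ => true
  | Seq p q | If _ p q => loopfree p && loopfree q
  | While _ _ => false
  end.

(* Meaningful on loop-free programs only: loops are skipped. *)
Fixpoint run (p : program) (s : store) : store :=
  match p with
  | Skip | While _ _ => s
  | Put a x y => update s a (eval s x) (eval s y)
  | Seq p q => run q (run p s)
  | If x p q => if eval s x == 0 then run q s else run p s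
  end.

Fixpoint run_cost (p : program) : nat :=
  match p with
  | Skip | While _ _ => 1
  | Put a x y => (cost x + cost y).+1
  | Seq p q => (run_cost p + run_cost q).+1
  | If x p q => (cost x + maxn (run_cost p) (run_cost q)).+1
  end.

Lemma runs_run p s T (Q : store -> Prop) :
  loopfree p -> run_cost p <= T -> Q (run p s) -> runs p s T Q.
Proof.
move=> lf leT q.
suff [t [e le]] : exists t, exec p s (run p s) t /\ t <= run_cost p.
  by exists (run p s), t; split=> //; apply: leq_trans le leT.
elim: p s lf {q leT} => //=.
- by move=> s _; exists 1; split=> //; apply: exec_skip.
- by move=> a x y s _; eexists; split; [apply: exec_put|].
- move=> p IHp q IHq s /andP[/(IHp s)[t1 [e1 le1]] /(IHq (run p s))[t2 [e2 le2]]].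
  by exists (t1 + t2).+1; split; [apply: exec_seq e1 e2|lia].
- move=> x p IHp q IHq s /andP[/(IHp s)[t1 [e1 le1]] /(IHq s)[t2 [e2 le2]]].
  case: eqP => [x0|/eqP x0].
    by exists (cost x + t2).+1; split; [apply: exec_if_false|lia].
  by exists (cost x + t1).+1; split; [apply: exec_if_true|lia].
Qed.

Definition Var (a : nat) : expr := Get a (Num 0).
Definition Assign (a : nat) (x : expr) : program := Put a (Num 0) x.
Definition Incr (a : nat) : program := Assign a (Plus (Var a) (Num 1)).

Definition For (i b : nat) (p : program) : program :=
  Seq (Assign i (Num 0)) (While (Minus (Var b) (Var i)) (Seq p (Incr i))).

(** The loop itself advances the counter, hence the [update] in the premise on the body. The 20
    extra steps per round leave room for the test and the increment. *)
Lemma runs_for (I : nat -> store -> Prop) i b p c s T :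
  i != b -> i \notin mods p -> b \notin mods p ->
  I 0 (update s i 0 0) ->
  (forall j s', j < s b 0 -> same_outside (i :: mods p) s s' -> s' i 0 = j ->
     I j s' -> runs p s' c (fun s'' => I j.+1 (update s'' i 0 j.+1))) ->
  s b 0 * (c + 20) + 20 <= T ->
  runs (For i b p) s T (I (s b 0)).
Proof.
move=> nib nip nbp I0 step leT; set N := s b 0 in step leT *.
apply: (@runs_seq _ _ _ 3 (N * (c + 20) + 10)); last by lia.
apply: runs_run => //=.
pose J B (s' : store) := exists j, [/\ j <= N, s' i 0 = j,
  same_outside (i :: mods p) s s', I j s' & (N - j) * (c + 20) + 10 <= B].
apply: (@runs_while J) => [B s' [j [lej ij fr Ij leB]]|]; last first.
  exists 0; split=> //; first by rewrite /update !eqxx.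
    by move=> a; rewrite inE negb_or /update => /andP[/negbTE -> _].
  by rewrite subn0.
have bN : s' b 0 = N by rewrite fr // inE negb_or eq_sym nib.
rewrite /= bN ij; case: eqP => [jN|/eqP nj].
  split; first by lia.
  by have -> : N = j by lia.
exists (c + 10), ((N - j.+1) * (c + 20) + 10); split; first by nia.
apply: (@runs_seq _ _ _ c 9); last by lia.
have ltj : j < N by lia.
apply: (runs_weaken (step j s' ltj fr ij Ij)) => // s1 fr1 I1.
have i1 : s1 i 0 = j by rewrite fr1.
apply: runs_run => //=; exists j.+1; rewrite i1 addn1; split=> //.
  by rewrite /update !eqxx.
move=> a; rewrite inE negb_or => /andP[ai ap].
by rewrite /update (negbTE ai) fr1 // fr // inE negb_or ai.
Qed.

Fixpoint linked (nx : nat -> nat) (h : nat) (l : seq nat) : Prop :=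
  if l is x :: l' then h = x.+1 /\ linked nx (nx x) l' else h = 0.

Definition Traverse (h nx : nat) (p : program) : program :=
  While (Var h) (Seq p (Assign h (Get nx (Minus (Var h) (Num 1))))).

Lemma runs_traverse (I : seq nat -> store -> Prop) h nx p c s T l :
  h != nx -> h \notin mods p -> nx \notin mods p ->
  linked (s nx) (s h 0) l ->
  I [::] s ->
  (forall l1 x l2 s', l = l1 ++ x :: l2 ->
     same_outside (h :: mods p) s s' -> s' h 0 = x.+1 ->
     I l1 s' -> runs p s' c (fun s'' => I (rcons l1 x) (update s'' h 0 (s nx x)))) ->
  size l * (c + 20) + 20 <= T ->
  runs (Traverse h nx p) s T (I l).
Proof.
move=> nhx nhp nxp lk I0 step leT.
pose J B (s' : store) := exists l1 l2, [/\ l = l1 ++ l2, linked (s nx) (s' h 0) l2,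
  same_outside (h :: mods p) s s', I l1 s' & size l2 * (c + 20) + 10 <= B].
apply: (@runs_while J) => [B s' [l1 [l2 [el lk2 fr Il leB]]]|]; last first.
  by exists [::], l; split=> //; lia.
have xn : s' nx = s nx by rewrite fr // inE negb_or eq_sym nhx.
case: l2 el lk2 leB => [|x l2] el /= lk2 leB; rewrite /=.
  by rewrite lk2 /= el cats0; split=> //; lia.
case: lk2 => hx lk2; rewrite hx /=.
exists (c + 10), (size l2 * (c + 20) + 10); split; first by nia.
apply: (@runs_seq _ _ _ c 9); last by lia.
apply: (runs_weaken (step _ _ _ _ el fr hx Il)) => // s1 fr1 I1.
have h1 : s1 h 0 = x.+1 by rewrite fr1.
have nx1 : s1 nx = s nx by rewrite fr1.
apply: runs_run => //=; rewrite h1 nx1 subn1 /=.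
exists (rcons l1 x), l2; split=> //; first by rewrite cat_rcons.
  by rewrite /update !eqxx.
move=> a; rewrite inE negb_or => /andP[ai ap].
by rewrite /update (negbTE ai) fr1 // fr // inE negb_or ai.
Qed.

(** * The program *)

(* Arrays 0-9 hold the input and 0-2 finally the output.  Of the others,
   10-15 hold |V(G)|, |V(G')|, |E(G')|, |V(T)|, |E(T)| and 2|E(G')|; 16, 17 and 46 are
   loop variables; 20 and 21 list the origins and targets of the half-edges of G', an
   edge i oriented as in T being the half-edges i and |E(G')| + i; 22-23, 24-25 and
   26-27 are linked lists (heads and successors) of the half-edges by origin, and of
   the edges and vertices of G' by image; 30 holds the labels and 31-33 the queue of
   the search, with its ends; 40 holds the number of the last bag that each label was
   written to, 41 the number of the current bag, 42 the output position and 43 that of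
   the size of the current bag; 34-36, 44 and 45 are temporary.  List pointers and
   labels are shifted by one, so that 0 stands for none. *)
Local Notation "p ;; q" := (Seq p q) (at level 60, right associativity).

(** Reversed because entries are inserted at the head: the list decreases and starts with the
    largest index of key [k]. *)
Definition chain (K : nat -> nat) (N k : nat) : seq nat :=
  rev [seq i <- iota 0 N | K i == k].

Definition head_code (l : seq nat) : nat := if l is x :: _ then x.+1 else 0.

Lemma chainS K N k :
  chain K N.+1 k = if K N == k then N :: chain K N k else chain K N k.
Proof.
by rewrite /chain -addn1 iotaD filter_cat rev_cat /= add0n; case: eqP.
Qed.

Lemma mem_chain K N k x : (x \in chain K N k) = (x < N) && (K x == k).
Proof. by rewrite mem_rev mem_filter mem_iota /= andbC. Qed.

Lemma linked_chain K nx N k :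
  (forall i, i < N -> nx i = head_code (chain K i (K i))) ->
  linked nx (head_code (chain K N k)) (chain K N k).
Proof.
elim: N => [|N IH] nxE //; rewrite chainS.
have {}IH := IH (fun i lti => nxE i (ltnW lti)).
by case: eqP => [KN|_] //=; rewrite nxE // KN.
Qed.

Definition Bucket (i K b H nx : nat) : program :=
  For i b (Put nx (Var i) (Get H (Get K (Var i))) ;;
           Put H (Get K (Var i)) (Plus (Var i) (Num 1))).

(** The successor of [i] is the largest smaller index with the same key, frozen when [i] was
    inserted. For the edges of G' bucketed by image it is the predecessor of [i] on its path. *)
Definition buckets (K : nat -> nat) (N : nat) (H nx : nat -> nat) : Prop :=
  (forall k, H k = head_code (chain K N k)) /\
  (forall i, i < N -> nx i = head_code (chain K i (K i))).

Lemma runs_bucket i K b H nx s T :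
  uniq [:: i; K; b; H; nx] -> (forall k, s H k = 0) ->
  s b 0 * 50 + 20 <= T ->
  runs (Bucket i K b H nx) s T
    (fun s' => buckets (s K) (s b 0) (s' H) (s' nx)).
Proof.
rewrite /= !inE !negb_or -!andbA.
case/and5P=> iK ib iH inx /and5P[Kb KH Knx bH /and3P[bnx Hnx _]] H0 leT.
pose I j (s' : store) := buckets (s K) j (s' H) (s' nx).
apply: (@runs_for I _ _ _ 30) => //=; rewrite ?inE ?negb_or ?inx ?bnx //.
  by split=> // k; rewrite /update eq_sym (negbTE iH) H0.
move=> j s' ltj fr ij [IH In]; apply: runs_run => //=.
have KE : s' K = s K by rewrite fr // !inE !negb_or eq_sym iK Knx.
have Hi : H != i by rewrite eq_sym.
have nxi : nx != i by rewrite eq_sym.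
have Ki : K != i by rewrite eq_sym.
have nxH : nx != H by rewrite eq_sym.
pose ne := (negbTE iH, negbTE inx, negbTE iK, negbTE Knx, negbTE Hnx, negbTE Hi,
  negbTE nxi, negbTE Ki, negbTE nxH, eqxx).
rewrite /I /update !ne /= ij KE.
split=> [k|x ltx].
  by rewrite chainS eq_sym; case: eqP => //= _; rewrite addn1.
case: eqP => [->|nej]; first exact: IH.
by apply: In; lia.
Qed.

(** * Simultaneous search from the vertices phi(v) *)

Section Search.
Variables (n N M2 : nat) (src tgt phi : nat -> nat).
Hypothesis tgt_lt : forall h, h < M2 -> tgt h < N.
Hypothesis phi_lt : forall i, i < n -> phi i < N.
Hypothesis phi_inj : forall i j, i < n -> j < n -> phi i = phi j -> i = j.

Definition search_init : program :=
  For 16 10 (Put 31 (Var 16) (Get 6 (Var 16)) ;;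
             Put 30 (Get 6 (Var 16)) (Plus (Var 16) (Num 1))) ;;
  Assign 32 (Num 0) ;; Assign 33 (Var 10).

Definition search_step : program :=
  Assign 35 (Get 21 (Minus (Var 36) (Num 1))) ;;
  If (Get 30 (Var 35)) Skip
     (Put 30 (Var 35) (Get 30 (Var 34)) ;; Put 31 (Var 33) (Var 35) ;; Incr 33).

Definition search_loop : program :=
  While (Minus (Var 33) (Var 32))
    (Assign 34 (Get 31 (Var 32)) ;; Assign 36 (Get 22 (Var 34)) ;;
     Traverse 36 23 search_step ;; Incr 32).

(** [q] is the whole order of discovery, with the [k] dequeued vertices kept, because the parent of
    a later vertex is looked up among the earlier ones. Parents share the label of their child,
    which is what makes the classes connected. *)
Definition queue_ok (q : seq nat) (k : nat) (Q L : nat -> nat) : Prop :=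
  [/\ forall i, i < size q -> Q i = nth 0 q i,
      uniq q /\ {in q, forall y, y < N},
      forall y, (L y != 0) = (y \in q),
      n <= size q /\ forall i, i < n -> nth 0 q i = phi i /\ L (phi i) = i.+1 &
      (forall j, n <= j < size q -> exists2 h, h < M2 &
        [/\ tgt h = nth 0 q j, src h \in take j q & L (src h) = L (tgt h)]) /\
      (forall h, h < M2 -> src h \in take k q -> tgt h \in q)].

(** Only the unlabelled vertex [tgt h] gets a new label, so the recorded parents stay valid; its own
    parent is the vertex at position [k], now being explored. *)
Lemma queue_push q k Q L h :
  queue_ok q k Q L -> k < size q -> h < M2 -> src h = nth 0 q k ->
  L (tgt h) = 0 ->
  queue_ok (rcons q (tgt h)) k
    (fun i => if i == size q then tgt h else Q i)
    (fun y => if y == tgt h then L (src h) else L y).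
Proof.
case=> QE [uq ltq] LE [nq phiE] [tr cl] ltk lth srcE L0.
have srcq : src h \in q by rewrite srcE mem_nth.
have tgtq : tgt h \notin q by rewrite -LE L0.
have nst (y : nat) : y \in q -> (y == tgt h) = false.
  by move=> yq; apply/eqP => E; rewrite -E yq in tgtq.
split.
- move=> i; rewrite size_rcons ltnS nth_rcons; case: ltngtP => // lti _.
  exact: QE.
- split; first by rewrite rcons_uniq tgtq.
  by move=> y; rewrite mem_rcons inE => /orP[/eqP->|/ltq //]; apply: tgt_lt.
- move=> y; rewrite mem_rcons inE; case: (y =P tgt h) => _ /=; last exact: LE.
  by rewrite -[RHS]srcq; apply: LE.
- split; first by rewrite size_rcons; lia.
  move=> i lti; have [e1 e2] := phiE i lti.
  rewrite nth_rcons (leq_trans lti nq); split=> //.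
  by rewrite nst // -e1 mem_nth // (leq_trans lti nq).
- split=> [j|h' lth'].
    rewrite size_rcons ltnS => /andP[lenj]; rewrite leq_eqVlt => /orP[/eqP->|ltj].
      exists h => //; rewrite nth_rcons ltnn eqxx; split=> //.
        by rewrite -cats1 take_cat ltnn subnn take0 cats0.
      by rewrite eqxx nst.
    have [|h' lth' [e1 e2 e3]] := tr j; first by rewrite lenj.
    exists h' => //; rewrite nth_rcons ltj; split=> //.
      by rewrite -cats1 take_cat ltj.
    rewrite !nst //; first by rewrite e1 mem_nth.
    exact: mem_take e2.
  rewrite -cats1 take_cat ltk mem_cat => /(cl _ lth') ->; by [].
Qed.

Lemma runs_search_init s T :
  s 10 0 = n -> (forall i, i < n -> s 6 i = phi i) -> (forall y, s 30 y = 0) ->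
  n * 50 + 40 <= T ->
  runs search_init s T (fun s' => exists q, [/\ queue_ok q 0 (s' 31) (s' 30),
    s' 32 0 = 0 & s' 33 0 = size q]).
Proof.
move=> n10 phi6 L0 leT.
apply: (@runs_seq _ _ _ (n * 50 + 20) 10); last by lia.
pose I j (s' : store) := [/\ forall i, i < j -> s' 31 i = phi i,
  forall i, i < j -> s' 30 (phi i) = i.+1 &
  forall y, (s' 30 y != 0) = (y \in [seq phi i | i <- iota 0 j])].
apply: (@runs_weaken _ _ (n * 50 + 20) _ (I n)) => //.
  rewrite -n10; apply: (@runs_for I _ _ _ 30) => //.
    by split=> // y; rewrite /update /= L0.
  rewrite n10 => j s' ltj fr j16 [I1 I2 I3]; apply: runs_run => //=.
  rewrite /I /update /= j16 (fr 6 isT) (phi6 _ ltj); split.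
  - move=> i; rewrite ltnS leq_eqVlt => /orP[/eqP->|lti]; first by rewrite eqxx.
    by rewrite (ltn_eqF lti) I1.
  - move=> i; rewrite ltnS leq_eqVlt => /orP[/eqP->|lti].
      by rewrite eqxx addn1.
    (* Injectivity of [phi] keeps the earlier labels from being overwritten. *)
    case: eqP => [/(phi_inj (ltn_trans lti ltj) ltj) E|_]; first by lia.
    exact: I2.
  - move=> y; rewrite -[phi 0 :: _]/([seq phi i | i <- iota 0 j.+1]) -[j.+1]addn1.
    rewrite iotaD map_cat mem_cat /= inE add0n -I3.
    by case: (y =P phi j) => _; rewrite ?addn1 ?orbT ?orbF.
move=> s1 fr1 [I1 I2 I3]; apply: runs_run => //=.
exists [seq phi i | i <- iota 0 n]; rewrite /update /=; split=> //; last first.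
  by rewrite (fr1 10 isT) n10 size_map size_iota.
have nthE i : i < n -> nth 0 [seq phi i | i <- iota 0 n] i = phi i.
  by move=> lti; rewrite (nth_map 0) ?size_iota // nth_iota.
split=> //.
- by move=> i; rewrite size_map size_iota => lti; rewrite nthE // I1.
- split; first rewrite map_inj_in_uniq ?iota_uniq // => i j.
    by rewrite !mem_iota /= !add0n; apply: phi_inj.
  by move=> y /mapP[i]; rewrite mem_iota => /andP[_ lti] ->; apply: phi_lt.
- by rewrite size_map size_iota; split=> // i lti; rewrite nthE // I2.
- by rewrite take0; split=> // j; rewrite size_map size_iota; lia.
Qed.

(** The queue only grows at its end, so position [k] keeps its vertex. The [update] of 36
    anticipates the pointer move made by [Traverse]. *)
Lemma runs_search_step s k q (l1 : seq nat) h v :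
  s 21 h = tgt h -> h < M2 -> src h = nth 0 q k -> k < size q ->
  s 34 0 = src h -> s 36 0 = h.+1 ->
  queue_ok q k (s 31) (s 30) -> s 33 0 = size q ->
  {in l1, forall h, tgt h \in q} ->
  runs search_step s 40 (fun s' => exists q',
    [/\ queue_ok q' k (update s' 36 0 v 31) (update s' 36 0 v 30),
        k < size q' /\ take k.+1 q' = take k.+1 q, update s' 36 0 v 33 0 = size q',
        update s' 36 0 v 34 0 = s 34 0 &
        {in rcons l1 h, forall h, tgt h \in q'}]).
Proof.
move=> tgtE lth srcE ltk xE hE qok szE l1q; apply: runs_run => //=.
rewrite /update /= hE subn1 /= tgtE.
have [QE uq LE _ _] := qok.
case: eqP => [L0|/eqP L0].
  exists (rcons q (tgt h)); rewrite /= xE szE; split=> //.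
  - exact: queue_push.
  - split; first by rewrite size_rcons; lia.
    rewrite -cats1 takel_cat //.
  - by rewrite size_rcons addn1.
  - move=> h'; rewrite mem_rcons inE mem_rcons inE => /orP[/eqP->|/l1q ->].
      by rewrite eqxx.
    by rewrite orbT.
exists q; rewrite /=; split=> //.
by move=> h'; rewrite mem_rcons inE => /orP[/eqP->|/l1q //]; rewrite -LE.
Qed.

(** Each index lies in one chain only; this is the amortisation that charges every half-edge once,
    to its origin. *)
Lemma sum_chain K M : \sum_(y < N) size (chain K M y) <= M.
Proof.
elim: M => [|M IH]; first by rewrite big1.
pose d y := (K M == y : nat).
rewrite (eq_bigr (fun y : 'I_N => size (chain K M y) + d y)) => [|y _].
  rewrite big_split /= -(addn1 M) leq_add // /d.
  have [lt|ge] := ltnP (K M) N.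
    rewrite (bigD1 (Ordinal lt)) //= eqxx big1 // => y.
    by rewrite -val_eqE /= eq_sym => /negbTE ->.
  by rewrite big1 // => y _; apply/eqP; rewrite eqb0; have := ltn_ord y; lia.
by rewrite chainS /d; case: eqP; rewrite ?addn0 //= addn1.
Qed.

Lemma runs_search_loop s T q :
  (forall h, h < M2 -> s 21 h = tgt h) ->
  buckets src M2 (s 22) (s 23) ->
  queue_ok q 0 (s 31) (s 30) -> s 32 0 = 0 -> s 33 0 = size q ->
  N * 100 + M2 * 100 + 20 <= T ->
  runs search_loop s T (fun s' => exists q, queue_ok q (size q) (s' 31) (s' 30)).
Proof.
move=> tgtE [HE nxE] qok0 h0 t0 leT.
pose w y := 100 + 100 * size (chain src M2 y).
pose W := \sum_(y <- iota 0 N) w y.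
have leW : W <= N * 100 + M2 * 100.
  rewrite /W -[N in iota 0 N]subn0 -/(index_iota 0 N) big_mkord /w big_split /=.
  rewrite sum_nat_const card_ord -big_distrr /= leq_add2l mulnC.
  by rewrite leq_mul2r sum_chain orbT.
pose md := [:: 34; 36; 35; 30; 31; 33; 32].
(* Each vertex y is dequeued once and then pays w y. *)
pose I b (s' : store) := exists q k, [/\ queue_ok q k (s' 31) (s' 30),
  s' 32 0 = k /\ s' 33 0 = size q, k <= size q,
  same_outside md s s' & W + 20 <= b + \sum_(y <- take k q) w y].
apply: (@runs_while I) => [b s1 [q1 [k [qok [e32 e33] lek fr leb]]]|]; last first.
  exists q, 0; split=> //; rewrite take0 big_nil; lia.
have sub_le (r : seq nat) : uniq r -> {in r, forall y, y < N} -> \sum_(y <- r) w y <= W.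
  move=> ur ltr; apply: (uniq_sub_le_big leqnn).
  - by move=> x y; apply: leq_addr.
  - by [].
  - exact: iota_uniq.
  - move=> y yr; rewrite mem_iota; exact: ltr.
rewrite /= e32 e33; have [_ [uq ltq] _ _ _] := qok.
have take_le j : \sum_(y <- take j q1) w y <= W.
  apply: sub_le; first exact: take_uniq.
  by move=> y /mem_take /ltq.
case: eqP => [le|/eqP lt].
  split; first by have := take_le k; lia.
  by exists q1; have <- : k = size q1 by lia.
have ltk : k < size q1 by lia.
pose x := nth 0 q1 k.
have xtake : take k.+1 q1 = rcons (take k q1) x by rewrite (take_nth 0).
have sumS : \sum_(y <- take k.+1 q1) w y = \sum_(y <- take k q1) w y + w x.
  by rewrite xtake -cats1 big_cat big_seq1.
have := take_le k.+1; rewrite sumS => leWx.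
exists (w x - 10), (b - w x); split; first by have : 100 <= w x by []; lia.
have [QE _ _ _ _] := qok.
apply: (@runs_seq _ _ _ 10 (w x - 30)); last by rewrite /w; lia.
apply: runs_run => //; rewrite /run /= e32 QE // -/x.
set s2 := update _ _ _ _.
apply: (@runs_seq _ _ _ 10 (w x - 50)); last by rewrite /w; lia.
apply: runs_run => //; rewrite /run /=.
have -> : s2 22 (s2 34 0) = head_code (chain src M2 x).
  by rewrite /s2 /update /= (fr 22 isT) HE.
set s3 := update _ _ _ _.
apply: (@runs_seq _ _ _ (100 * size (chain src M2 x) + 30) 10); last by rewrite /w; lia.
pose J (l1 : seq nat) (s' : store) := exists q', [/\ queue_ok q' k (s' 31) (s' 30),
  k < size q' /\ take k.+1 q' = take k.+1 q1, s' 33 0 = size q',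
  s' 34 0 = x & {in l1, forall h, tgt h \in q'}].
apply: (@runs_weaken _ _ (100 * size (chain src M2 x) + 30) _ (J (chain src M2 x))) => //.
  apply: (@runs_traverse J _ _ _ 40) => //; last by lia.
  - by rewrite /s3 /s2 /update /= (fr 23 isT); apply: linked_chain.
  - by exists q1; rewrite /s3 /s2 /update /=.
  - move=> l1 h l2 s' El fr' e36 [q' [qok' [ltk' takeE] e33' e34' l1q]].
    have : h \in chain src M2 x by rewrite El mem_cat inE eqxx orbT.
    rewrite mem_chain => /andP[lth /eqP srch].
    have xq' : nth 0 q' k = x.
      by rewrite -(nth_take 0 (ltnSn k) q') takeE nth_take.
    apply: (@runs_weaken _ _ 40);
      first apply: (@runs_search_step s' k q' l1 h (s3 23 h)) => //.
    - by rewrite (fr' 21 isT) /s3 /s2 /update /= (fr 21 isT) tgtE.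
    - by rewrite srch.
    - by rewrite srch.
    - by [].
    - move=> s'' _ [q'' [? [? E] ? e34 ?]]; exists q''; split=> //.
        by split=> //; rewrite E.
      by rewrite e34.
move=> s4 fr4 [q' [qok' [ltk' takeE] e33' e34' l1q]].
apply: runs_run => //=; exists q', k.+1; rewrite /update /=; split.
(* The list of half-edges at position [k] is exhausted, so closure advances from [k] to [k.+1]. *)
- have [? ? ? ? [? cl]] := qok'; split=> //; split=> // h lth.
  rewrite (take_nth 0) // mem_rcons inE.
  have -> : nth 0 q' k = x by rewrite -(nth_take 0 (ltnSn k) q') takeE nth_take.
  case/orP=> [/eqP srch|]; last exact: cl.
  by apply: l1q; rewrite mem_chain lth srch eqxx.
- by rewrite addn1 (fr4 32 isT) /s3 /s2 /update /= e32.
- by [].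
- move=> a am; have ne c : c \in md -> (a == c) = false.
    by move=> cm; apply/eqP => E; rewrite E cm in am.
  rewrite ne //= (fr4 a) ?inE ?ne //.
  by rewrite /s3 /s2 /update !ne // fr.
- by rewrite takeE sumS; lia.
Qed.

(* The ranks rk witness that following the half-edges back from any labelled vertex
   ends in some phi i. *)
Definition labelling (L : nat -> nat) : Prop :=
  exists rk : nat -> nat,
  [/\ forall i, i < n -> L (phi i) = i.+1,
      forall h, h < M2 -> L (src h) != 0 -> L (tgt h) != 0 &
      forall y, L y != 0 -> (exists2 i, i < n & y = phi i) \/
        exists2 h, h < M2 & [/\ tgt h = y, L (src h) = L y & rk (src h) < rk y]].

(** The position in the order of discovery serves as rank; with every vertex dequeued, closure holds
    at all labelled vertices. *)
Lemma queue_labelling q Q L : queue_ok q (size q) Q L -> labelling L.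
Proof.
case=> QE [uq _] LE [nq phiE] [tr]; rewrite take_size => cl.
exists (index^~ q); split=> [i /phiE[] //|h lth|y].
  by rewrite !LE; apply: cl.
rewrite LE => yq; have [lt|ge] := ltnP (index y q) n.
  by left; exists (index y q) => //; have [<- _] := phiE _ lt; rewrite nth_index.
right; have [|h lth [e1 e2 e3]] := tr (index y q); first by rewrite ge index_mem.
rewrite nth_index // in e1; exists h => //; split=> //; first by rewrite e3 e1.
by move: (e2); rewrite in_take // (mem_take e2).
Qed.
End Search.

(** The absolute difference: subtraction truncates and tests only see zero. *)
Definition Differ (x y : expr) : expr := Plus (Minus x y) (Minus y x).

Lemma eval_differ s x y : (eval s (Differ x y) == 0) = (eval s x == eval s y).
Proof. by rewrite /=; lia. Qed.

Lemma run_if x p q s :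
  run (If x p q) s = if eval s x == 0 then run q s else run p s.
Proof. by []. Qed.

Lemma run_seq p q s : run (Seq p q) s = run q (run p s).
Proof. by []. Qed.

(** * Orientation of the edges and output of the tree *)

Definition setup : program :=
  Assign 10 (Var 0) ;; Assign 11 (Var 2) ;; Assign 12 (Get 2 (Num 1)) ;;
  Assign 13 (Var 4) ;; Assign 14 (Get 4 (Num 1)) ;; Assign 15 (Plus (Var 12) (Var 12)).

Definition orient : program :=
  let p0 := Get 3 (Plus (Var 16) (Var 16)) in
  let p1 := Get 3 (Plus (Plus (Var 16) (Var 16)) (Num 1)) in
  let e := Get 8 (Var 16) in
  let put x y :=
    Put 20 (Var 16) x ;; Put 21 (Var 16) y ;;
    Put 20 (Plus (Var 12) (Var 16)) y ;; Put 21 (Plus (Var 12) (Var 16)) x in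
  For 16 12 (If (Differ (Get 7 p0) (Get 5 (Plus e e))) (put p1 p0) (put p0 p1)).

Section Orient.
Variable s0 : store.

(** Edges of T are oriented by the order in which their ends are listed. One comparison orients [i],
    since a morphism maps the ends of an edge onto the ends of its image; the boolean then serves as
    an offset into the pair of ends. *)
Definition matches (i : nat) : bool :=
  s0 7 (s0 3 (i + i)) == s0 5 (s0 8 i + s0 8 i).
Definition low (i : nat) : nat := s0 3 (i + i + ~~ matches i).
Definition high (i : nat) : nat := s0 3 (i + i + matches i).

Definition oriented (M : nat) (src tgt : nat -> nat) : Prop :=
  forall i, i < M ->
    [/\ src i = low i, tgt i = high i, src (M + i) = high i & tgt (M + i) = low i].

Lemma runs_orient s T :
  s 3 = s0 3 -> s 5 = s0 5 -> s 7 = s0 7 -> s 8 = s0 8 ->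
  s 12 0 * 150 + 20 <= T ->
  runs orient s T (fun s' => oriented (s 12 0) (s' 20) (s' 21)).
Proof.
move=> e3 e5 e7 e8 leT; set M := s 12 0.
pose I j (s' : store) := forall i, i < j ->
  [/\ s' 20 i = low i, s' 21 i = high i, s' 20 (M + i) = high i & s' 21 (M + i) = low i].
apply: (@runs_for I _ _ _ 130) => // j s' ltj fr j16 Ij; apply: runs_run => //.
have e12 : s' 12 0 = M by rewrite fr.
have eM : eval s' (Differ (Get 7 (Get 3 (Plus (Var 16) (Var 16))))
   (Get 5 (Plus (Get 8 (Var 16)) (Get 8 (Var 16))))) == 0 = matches j.
  by rewrite eval_differ /= j16 !(fr 3 isT, fr 5 isT, fr 7 isT, fr 8 isT) e3 e5 e7 e8.
rewrite run_if eM => i lti.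
have [E1 E2] : (M + i == j) = false /\ (i == M + j) = false.
  by rewrite /M in ltj *; split; lia.
have [E|ne] := eqVneq i j.
  have E2' : (i == M + i) = false by rewrite {2}E.
  rewrite E /low /high; case: (matches j);
    by rewrite /= /update /= !j16 !e12 !(fr 3 isT) !e3 ?eqxx ?addn0 -E ?[i == _]E2' ?eqxx.
have E3 : (M + i == M + j) = false by rewrite eqn_add2l (negbTE ne).
have [|? ? ? ?] := Ij i; first by lia.
by case: (matches j); rewrite /= /update /= !j16 !e12 E1 E2 E3 (negbTE ne) /=.
Qed.

(** The first loop joins each edge of G' to the node below it, the second joins the last node of
    each path to the far end of its edge of T. As the lists decrease, these nodes are the list
    successor and the list head. Without a successor, the entry first written is replaced by the
    near end. *)
Definition write_edges : program :=
  For 16 12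
    (Put 1 (Plus (Var 16) (Var 16)) (Plus (Var 13) (Var 16)) ;;
     Put 1 (Plus (Plus (Var 16) (Var 16)) (Num 1))
       (Plus (Var 13) (Minus (Get 25 (Var 16)) (Num 1))) ;;
     If (Get 25 (Var 16)) Skip
       (Put 1 (Plus (Plus (Var 16) (Var 16)) (Num 1))
          (Get 5 (Plus (Get 8 (Var 16)) (Get 8 (Var 16)))))) ;;
  For 16 14
    (Assign 17 (Plus (Var 12) (Var 16)) ;;
     Put 1 (Plus (Var 17) (Var 17))
       (Plus (Var 13) (Minus (Get 24 (Var 16)) (Num 1))) ;;
     Put 1 (Plus (Plus (Var 17) (Var 17)) (Num 1))
       (Get 5 (Plus (Plus (Var 16) (Var 16)) (Num 1)))).

(** [head] falls back to 0 only for an edge of T with nothing above it, which a harmonic morphism of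
    positive degree excludes. *)
Definition edges_written (M nT mT : nat) (a : nat -> nat) : Prop :=
  (forall i, i < M -> a (i + i) = nT + i /\
     a (i + i + 1) = if chain (s0 8) i (s0 8 i) is p :: _ then nT + p
                     else s0 5 (s0 8 i + s0 8 i)) /\
  (forall i, i < mT -> a (M + i + (M + i)) = nT + head 0 (chain (s0 8) M i) /\
     a (M + i + (M + i) + 1) = s0 5 (i + i + 1)).

Lemma runs_write_edges s T :
  s 5 = s0 5 -> s 8 = s0 8 -> buckets (s0 8) (s 12 0) (s 24) (s 25) ->
  s 12 0 * 100 + s 14 0 * 100 + 50 <= T ->
  runs write_edges s T
    (fun s' => edges_written (s 12 0) (s 13 0) (s 14 0) (s' 1)).
Proof.
move=> e5 e8 [HE nxE] leT; set M := s 12 0 in HE nxE leT *.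
set nT := s 13 0; set mT := s 14 0 in leT *.
apply: (@runs_seq _ _ _ (M * 100 + 20) (mT * 100 + 20)); last by lia.
pose I j (s' : store) := forall i, i < j -> s' 1 (i + i) = nT + i /\
     s' 1 (i + i + 1) = if chain (s0 8) i (s0 8 i) is p :: _ then nT + p
                     else s0 5 (s0 8 i + s0 8 i).
apply: (@runs_weaken _ _ (M * 100 + 20) _ (I M)) => //.
  apply: (@runs_for I _ _ _ 80) => // j s' ltj fr j16 Ij; apply: runs_run => //.
  have e25 : s' 25 j = head_code (chain (s0 8) j (s0 8 j)).
    by rewrite (fr 25 isT) nxE.
  move=> i lti; rewrite /run /= /update /=.
  rewrite !(fr 13 isT, fr 5 isT, fr 8 isT) -/nT e5 e8 !j16 e25.
  have E1 : (i + i == j + j + 1) = false by lia.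
  have E2 : (i + i + 1 == j + j) = false by lia.
  have [E|ne] := eqVneq i j.
    by rewrite -E in E1 E2 *; case: (chain _ _ _) => [|y l] /=;
      rewrite !eqxx ?E1 ?E2 /= ?subn1.
  have E3 : (i + i == j + j) = false by lia.
  have E4 : (i + i + 1 == j + j + 1) = false by lia.
  have [|I1 I2] := Ij i; first by lia.
  by case: eqP => _ /=; rewrite E1 E2 E3 E4 /=.
move=> s1 fr1 IM.
pose J j (s' : store) := I M s' /\ forall i, i < j ->
  s' 1 (M + i + (M + i)) = nT + head 0 (chain (s0 8) M i) /\
     s' 1 (M + i + (M + i) + 1) = s0 5 (i + i + 1).
have e14 : s1 14 0 = mT by rewrite fr1.
rewrite /edges_written -/(I M) -e14.
apply: (@runs_weaken _ _ (s1 14 0 * 100 + 20) _ (J (s1 14 0))) => //.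
apply: (@runs_for J _ _ _ 80) => //.
rewrite e14 => j s' ltj fr j16 [IM' Jj]; apply: runs_run => //.
have e24 : s' 24 j = head_code (chain (s0 8) M j).
  by rewrite (fr 24 isT) (fr1 24 isT) HE.
have e13 : s' 13 0 = nT by rewrite (fr 13 isT) (fr1 13 isT).
have e12 : s' 12 0 = M by rewrite (fr 12 isT) (fr1 12 isT).
rewrite /J /I /run /update /= !j16 !e12 e13 (fr 5 isT) (fr1 5 isT) e5 e24.
split=> i lti.
  have E1 : (i + i == M + j + (M + j)) = false by lia.
  have E2 : (i + i == M + j + (M + j) + 1) = false by lia.
  have E3 : (i + i + 1 == M + j + (M + j)) = false by lia.
  have E4 : (i + i + 1 == M + j + (M + j) + 1) = false by lia.
  by rewrite E1 E2 E3 E4; apply: IM'.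
have E1 : (M + i + (M + i) == M + j + (M + j) + 1) = false by lia.
have E2 : (M + i + (M + i) + 1 == M + j + (M + j)) = false by lia.
rewrite E1 E2 /=; have [E|ne] := eqVneq i j.
  by rewrite -E !eqxx; split=> //; case: (chain _ _ _) => [|y l] /=; rewrite ?subn1.
have E3 : (M + i + (M + i) == M + j + (M + j)) = false by lia.
have E4 : (M + i + (M + i) + 1 == M + j + (M + j) + 1) = false by lia.
by rewrite E3 E4; apply: Jj; lia.
Qed.
End Orient.

(** * Bags written without repetition *)

Definition add_new (c : seq nat) (l : nat) : seq nat :=
  if l \in c then c else rcons c l.

Lemma mem_foldl_add_new ls c l :
  (l \in foldl add_new c ls) = (l \in c) || (l \in ls).
Proof.
elim: ls c => [|a ls IH] c /=; first by rewrite orbF.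
rewrite IH inE /add_new; case: ifP => [ac|_]; last first.
  by rewrite mem_rcons inE orbCA orbA.
by case: eqP => [->|]; rewrite ?ac.
Qed.

Lemma uniq_foldl_add_new ls c : uniq c -> uniq (foldl add_new c ls).
Proof.
elim: ls c => [|a ls IH] c //= uc; apply: IH; rewrite /add_new.
by case: ifP => // /negbT nac; rewrite rcons_uniq nac.
Qed.

(** Membership in the current bag is one comparison of stamps, and nothing has to be cleared between
    bags. Bags are numbered from 1, so initial zeros never pass for a stamp. *)
Definition emit (x : expr) : program :=
  Assign 45 (Get 30 x) ;;
  If (Differ (Get 40 (Var 45)) (Var 41))
    (Put 40 (Var 45) (Var 41) ;; Put 2 (Var 42) (Minus (Var 45) (Num 1)) ;; Incr 42)
    Skip.

(** The bound on the stamps makes them all stale as soon as the bag counter is raised. *)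
Definition written (out : seq nat) (s : store) : Prop :=
  [/\ s 42 0 = size out, forall i, i < size out -> s 2 i = nth 0 out i &
      forall l, s 40 l <= s 41 0].

(** Cell [size out] stays reserved for the size of the bag, known only when the bag is complete;
    [.-1] undoes the shift of the labels. *)
Definition open_bag (out c : seq nat) (s : store) : Prop :=
  [/\ s 43 0 = size out /\ s 42 0 = (size out).+1 + size c,
      forall i, i < size out -> s 2 i = nth 0 out i,
      forall i, i < size c -> s 2 ((size out).+1 + i) = (nth 0 c i).-1,
      forall l, (s 40 l == s 41 0) = (l \in c) &
      forall l, s 40 l <= s 41 0].

Lemma emit_open_bag out c x s :
  open_bag out c s ->
  open_bag out (add_new c (s 30 (eval s x))) (run (emit x) s).
Proof.
case=> [[e43 e42] outE cE mE mle]; rewrite /emit run_seq run_if eval_differ.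
set l := s 30 (eval s x).
rewrite /add_new -mE /= /update /= -/l; case: (s 40 l =P s 41 0) => [//|/eqP ne].
have nlc : l \notin c by rewrite -mE.
rewrite /open_bag /= e42 size_rcons; split.
- by split=> //; lia.
- move=> i lti; have -> : (i == (size out).+1 + size c) = false by lia.
  exact: outE.
- move=> i; rewrite ltnS nth_rcons eqn_add2l; case: ltngtP => // lti _.
    exact: cE.
  by rewrite subn1.
- move=> k; rewrite mem_rcons inE; case: (k =P l) => _; first by rewrite eqxx.
  exact: mE.
- by move=> k; case: (k =P l).
Qed.

Definition bag_prologue : program :=
  Incr 41 ;; Assign 43 (Var 42) ;; Incr 42.

Definition Bag (head : expr) (nx : nat) (body : program) : program :=
  bag_prologue ;; Assign 44 head ;; Traverse 44 nx body ;;
  Put 2 (Var 43) (Minus (Minus (Var 42) (Var 43)) (Num 1)).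

Definition bag_labels (em : nat -> seq nat) (L : nat -> nat) (l : seq nat) :=
  foldl add_new [::] [seq L x | x <- flatten [seq em i | i <- l]].

Definition bag_code (c : seq nat) : seq nat := size c :: map predn c.

(** One proof for both kinds of bags: [em] abstracts which vertices a list entry contributes, and
    the two lists of modified arrays are those of [vertex_body] and [edge_body]. *)
Lemma runs_bag head nx body em L s out l T :
  mods body = [:: 45; 40; 2; 42] \/ mods body = [:: 45; 40; 2; 42; 45; 40; 2; 42] ->
  nx \notin [:: 41; 43; 42; 44; 45; 40; 2] ->
  linked (s nx) (eval (run bag_prologue s) head) l ->
  written out s ->
  (forall s' x c, same_outside [:: 41; 43; 42; 44; 45; 40; 2] s s' ->
     s' 44 0 = x.+1 -> open_bag out c s' ->
     runs body s' 200 (open_bag out (foldl add_new c [seq L y | y <- em x]))) ->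
  size l * 250 + cost head + 100 <= T ->
  runs (Bag head nx body) s T
    (fun s' => written (out ++ bag_code (bag_labels em L l)) s').
Proof.
move=> modb nnx lk [e42 outE mle] body_ok leT.
have nxs : nx \notin mods body by move: nnx; rewrite !inE; case: modb => ->; rewrite !inE; lia.
apply: (@runs_seq _ _ _ 20 (size l * 250 + cost head + 70)); last by lia.
apply: runs_run => //; set s1 := run _ s in lk *.
apply: (@runs_seq _ _ _ (cost head + 5) (size l * 250 + 50)); last by lia.
apply: runs_run => //; first by rewrite /=; lia.
set s2 := run _ _.
have s1E a : a \notin [:: 41; 43; 42] -> s1 a = s a.
  rewrite !inE !negb_or => /and3P[/negbTE n1 /negbTE n2 /negbTE n3].
  by rewrite /s1 /= /update n1 n2 n3.
have s2E a : a \notin [:: 41; 43; 42; 44] -> s2 a = s a.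
  rewrite !inE !negb_or => /and4P[n1 n2 n3 n4].
  by rewrite /s2 /= /update (negbTE n4) s1E // !inE !negb_or n1 n2.
apply: (@runs_seq _ _ _ (size l * 220 + 20) 20); last by lia.
pose I l1 (s' : store) := open_bag out (bag_labels em L l1) s'.
apply: (@runs_weaken _ _ (size l * 220 + 20) _ (I l)) => //.
  apply: (@runs_traverse I _ _ _ 200) => //.
  - by move: nnx; rewrite !inE eq_sym; lia.
  - by case: modb => ->.
  - rewrite s2E; last by move: nnx; rewrite !inE; lia.
    by rewrite /s2 /= /update.
  - rewrite /I /open_bag /bag_labels /s2 /s1 /= /update /= e42; split=> //.
    + by rewrite addn1 addn0.
    + by move=> k; rewrite ?in_nil; have := mle k; lia.
    + by move=> k; have := mle k; lia.
  - move=> l1 x l2 s' El fr' e44 Il1.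
    have fr2 : same_outside [:: 41; 43; 42; 44; 45; 40; 2] s s'.
      move=> a an; rewrite fr' ?s2E //; move: an; rewrite !inE; first by lia.
      by case: modb => ->; rewrite !inE; lia.
    apply: (runs_weaken (body_ok s' x _ fr2 e44 Il1)) => // s'' _.
    rewrite /I /bag_labels map_rcons flatten_rcons map_cat foldl_cat.
    by case=> [] [? ?] ? ? ? ?; split.
move=> s3 fr3 [[e43 e42'] outE' cE mE mle']; apply: runs_run => //=.
rewrite /update /= e43 e42'; set c := bag_labels em L l in e42' cE mE *.
split=> //=.
- by rewrite e42' size_cat /= size_map; lia.
- move=> i; rewrite size_cat /= size_map => lti; rewrite nth_cat.
  case: (ltngtP i (size out)) => [lt|gt|->]; first exact: outE'.
    have -> : i = (size out).+1 + (i - (size out).+1) by lia.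
    set j := i - (size out).+1; rewrite cE; last by rewrite /j; lia.
    have -> : (size out).+1 + j - size out = j.+1 by lia.
    by rewrite /= (nth_map 0) // /j; lia.
  by rewrite subnn /=; lia.
Qed.

Definition vertex_body : program := emit (Minus (Var 44) (Num 1)).
(** When 46 holds i and 44 holds x + 1, the truncated differences are nonzero exactly for i <= x and
    for x <= i; both ends are emitted when x = i. *)
Definition edge_body : program :=
  If (Minus (Var 44) (Var 46)) (emit (Get 20 (Minus (Var 44) (Num 1)))) Skip ;;
  If (Minus (Plus (Var 46) (Num 2)) (Var 44))
     (emit (Get 21 (Minus (Var 44) (Num 1)))) Skip.

Definition write_bags : program :=
  For 46 13 (Bag (Get 26 (Var 46)) 27 vertex_body) ;;
  For 46 12 (Bag (Get 24 (Get 8 (Var 46))) 25 edge_body).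

Section Bags.
Variables (M N : nat) (fV fE src tgt L : nat -> nat).

Definition vertex_labels (w : nat) : seq nat :=
  bag_labels (fun x => [:: x]) L (chain fV N w).

Definition edge_emits (i x : nat) : seq nat :=
  (if i <= x then [:: src x] else [::]) ++ (if x <= i then [:: tgt x] else [::]).

Definition edge_labels (i : nat) : seq nat :=
  bag_labels (edge_emits i) L (chain fE M (fE i)).

Definition bags_code (nT : nat) : seq nat :=
  flatten ([seq bag_code (vertex_labels w) | w <- iota 0 nT] ++
           [seq bag_code (edge_labels i) | i <- iota 0 M]).

Lemma map_iotaS (A : Type) (F : nat -> A) j :
  [seq F i | i <- iota 0 j.+1] = rcons [seq F i | i <- iota 0 j] (F j).
Proof. by rewrite -addn1 iotaD map_cat cats1. Qed.

Lemma runs_write_bags s K T :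
  s 12 0 = M -> s 8 = fE -> s 20 = src -> s 21 = tgt -> s 30 = L ->
  buckets fV N (s 26) (s 27) -> buckets fE M (s 24) (s 25) ->
  (forall w, size (chain fV N w) <= K) -> (forall e, size (chain fE M e) <= K) ->
  s 41 0 = 0 -> (forall l, s 40 l = 0) -> s 42 0 = 0 ->
  (s 13 0 + M) * (K * 250 + 200) + 50 <= T ->
  runs write_bags s T (fun s' => written (bags_code (s 13 0)) s').
Proof.
move=> e12 e8 e20 e21 e30 [HV nV] [HE nE] leV leE e41 e40 e42 leT.
set nT := s 13 0 in leT *.
pose cV j := flatten [seq bag_code (vertex_labels w) | w <- iota 0 j].
apply: (@runs_seq _ _ _ (nT * (K * 250 + 200) + 20) (M * (K * 250 + 200) + 20)); last by lia.
pose I j (s' : store) := written (cV j) s'.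
apply: (@runs_weaken _ _ (nT * (K * 250 + 200) + 20) _ (I nT)) => //.
  apply: (@runs_for I _ _ _ (K * 250 + 150)) => //; last by rewrite -/nT; lia.
    by rewrite /I /written /cV /update /=; split=> // l; rewrite e40 e41.
  move=> j s' ltj fr j46 Ij.
  have bagok : runs (Bag (Get 26 (Var 46)) 27 vertex_body) s' (K * 250 + 150)
      (written (cV j ++ bag_code (vertex_labels j))).
    apply: (@runs_bag _ _ _ _ _ _ _ (chain fV N j)) => //.
    - by left.
    - rewrite /= /update /= j46 (fr 26 isT) (fr 27 isT) HV.
      exact: linked_chain.
    - move=> s2 x c fr2 e44 ob; apply: runs_run => //.
      have := emit_open_bag (Minus (Var 44) (Num 1)) ob.
      by rewrite [eval _ _]/= e44 subn1 (fr2 30 isT) (fr 30 isT) e30.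
    - have := leV j; rewrite /=; nia.
  apply: (runs_weaken bagok) => // s2 _.
  by rewrite /I /cV map_iotaS flatten_rcons.
move=> s1 fr1 I1.
pose cE j := flatten [seq bag_code (edge_labels i) | i <- iota 0 j].
pose J j (s' : store) := written (cV nT ++ cE j) s'.
apply: (@runs_weaken _ _ (M * (K * 250 + 200) + 20) _ (J M)) => //; last first.
  by move=> s2 _; rewrite /J /bags_code flatten_cat.
have e12' : s1 12 0 = M by rewrite (fr1 12 isT).
rewrite -[in J M]e12'.
apply: (@runs_for J _ _ _ (K * 250 + 150)) => //; last by rewrite e12'; lia.
  by rewrite /J /cE /= cats0; case: I1 => ? ? ?; split.
rewrite e12' => j s' ltj fr j46 Ij.
have fr' a : a \notin [:: 46; 41; 43; 42; 44; 45; 40; 2] -> s' a = s a.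
  by move=> an; rewrite fr ?fr1 //; move: an; rewrite !inE; lia.
have bagok : runs (Bag (Get 24 (Get 8 (Var 46))) 25 edge_body) s' (K * 250 + 150)
    (written ((cV nT ++ cE j) ++ bag_code (edge_labels j))).
  apply: (@runs_bag _ _ _ _ _ _ _ (chain fE M (fE j))) => //.
  - by right.
  - rewrite /= /update /= j46 (fr' 24 isT) (fr' 8 isT) (fr' 25 isT) e8 HE.
    exact: linked_chain.
  - move=> s2 x c fr2 e44 ob; apply: runs_run => //.
    rewrite /edge_emits map_cat foldl_cat /edge_body run_seq.
    have e46 : s2 46 0 = j by rewrite (fr2 46 isT).
    have L2 : s2 30 = L by rewrite (fr2 30 isT) fr'.
    have src2 : s2 20 = src by rewrite (fr2 20 isT) fr'.
    have tgt2 : s2 21 = tgt by rewrite (fr2 21 isT) fr'.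
    set s3 := run (If _ _ _) s2.
    have s3E : same_outside [:: 45; 40; 2; 42] s2 s3.
      have [//|s4 [t [ex _ s34]]] := @runs_run (If (Minus (Var 44) (Var 46))
        (emit (Get 20 (Minus (Var 44) (Num 1)))) Skip) s2 _ (eq s3) isT (leqnn _).
      by rewrite s34; apply: exec_frame ex.
    have ob3 : open_bag (cV nT ++ cE j) (foldl add_new c
        [seq L y | y <- if j <= x then [:: src x] else [::]]) s3.
      rewrite /s3 run_if.
      have -> : (eval s2 (Minus (Var 44) (Var 46)) == 0) = ~~ (j <= x).
        by rewrite /= e44 e46; lia.
      case: (j <= x) => //.
      have := emit_open_bag (Get 20 (Minus (Var 44) (Num 1))) ob.
      by rewrite [eval _ _]/= e44 subn1 L2 src2.
    rewrite run_if.
    have -> : (eval s3 (Minus (Plus (Var 46) (Num 2)) (Var 44)) == 0) = ~~ (x <= j).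
      by rewrite /= (s3E 46 isT) (s3E 44 isT) e44 e46; lia.
    case: (x <= j) => //.
    have := emit_open_bag (Get 21 (Minus (Var 44) (Num 1))) ob3.
    by rewrite [eval _ _]/= (s3E 44 isT) (s3E 30 isT) (s3E 21 isT) e44 subn1 L2 tgt2.
  - have := leE (fE j); rewrite /=; nia.
apply: (runs_weaken bagok) => // s2 _.
by rewrite /J /cE map_iotaS flatten_rcons catA.
Qed.
End Bags.

(** * The complete program *)

Definition decompose : program :=
  setup ;; orient ;; Bucket 16 20 15 22 23 ;; Bucket 16 8 12 24 25 ;;
  Bucket 16 7 11 26 27 ;; search_init ;; search_loop ;; write_edges ;;
  write_bags ;;
  Put 0 (Num 0) (Plus (Var 13) (Var 12)) ;;
  Put 0 (Num 1) (Plus (Var 12) (Var 14)).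

(** Stated for bare numbers: graphs enter only through the index bounds, the injectivity of array 6
    and the bound [K] on the fibers. *)
Lemma runs_decompose s0 K n N M nT mT T :
  (forall a i, 10 <= a -> s0 a i = 0) ->
  s0 0 0 = n -> s0 2 0 = N -> s0 2 1 = M -> s0 4 0 = nT -> s0 4 1 = mT ->
  (forall i, i < M + M -> s0 3 i < N) ->
  (forall i, i < n -> s0 6 i < N) ->
  (forall i j, i < n -> j < n -> s0 6 i = s0 6 j -> i = j) ->
  (forall w, size (chain (s0 7) N w) <= K) ->
  (forall e, size (chain (s0 8) M e) <= K) ->
  500 + n * 50 + N * 150 + M * 600 + mT * 100 + (nT + M) * (K * 250 + 200) <= T ->
  runs decompose s0 T (fun s => exists src tgt L,
    [/\ oriented s0 M src tgt, labelling n (M + M) src tgt (s0 6) L,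
        s 0 0 = nT + M /\ s 0 1 = M + mT,
        edges_written s0 M nT mT (s 1) &
        forall i, i < size (bags_code M N (s0 7) (s0 8) src tgt L nT) ->
          s 2 i = nth 0 (bags_code M N (s0 7) (s0 8) src tgt L nT) i]).
Proof.
move=> z en eN eM enT emT lt3 phi_lt phi_inj leV leE leT.
apply: (@runs_seq _ _ _ 50 (T - 60)); last by lia.
apply: runs_run => //; set s1 := run _ _.
have e1 a : a \notin [:: 10; 11; 12; 13; 14; 15] -> s1 a = s0 a.
  have [//|s' [t [ex _ <-]]] := @runs_run setup s0 _ (eq^~ s1) isT (leqnn _).
  by move=> an; apply: (exec_frame ex).
have [s1n s1N s1M s1nT s1mT] :
    [/\ s1 10 0 = n, s1 11 0 = N, s1 12 0 = M, s1 13 0 = nT & s1 14 0 = mT].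
  by rewrite /s1 /= /update /= en eN eM enT emT.
have s1M2 : s1 15 0 = M + M by rewrite /s1 /= /update /= eM.
move: s1 e1 s1n s1N s1M s1nT s1mT s1M2 => s1 e1 s1n s1N s1M s1nT s1mT s1M2.
apply: (@runs_seq _ _ _ (M * 150 + 20) (T - (M * 150 + 90))); last by lia.
apply: (runs_weaken (@runs_orient s0 s1 (M * 150 + 20) _ _ _ _ _)) => //.
- by rewrite e1.
- by rewrite e1.
- by rewrite e1.
- by rewrite e1.
- by rewrite s1M.
rewrite s1M => s2 fr2 ori.
have tgt_lt h : h < M + M -> s2 21 h < N.
  move=> lth; have [lt|ge] := ltnP h M.
    by have [_ -> _ _] := ori h lt; apply: lt3; case: (matches _ _); lia.
  have -> : h = M + (h - M) by lia.
  have [|_ _ _ ->] := ori (h - M); first by lia.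
  by apply: lt3; case: (matches _ _); lia.
set src := s2 20 in ori *; set tgt := s2 21 in ori tgt_lt.
have zero2 a i : 22 <= a -> s2 a i = 0.
  by move=> lea; rewrite fr2 ?e1 ?z //; rewrite ?inE; lia.
apply: (@runs_seq _ _ _ (M * 100 + 20) (T - (M * 250 + 120))); last by lia.
apply: (runs_weaken (@runs_bucket 16 20 15 22 23 s2 (M * 100 + 20) _ _ _)) => //.
- by move=> k; apply: zero2.
- by rewrite (fr2 15 isT) s1M2; lia.
rewrite (fr2 15 isT) s1M2 -/src => s3 fr3 buckH.
apply: (@runs_seq _ _ _ (M * 50 + 20) (T - (M * 300 + 150))); last by lia.
have M3 : s3 12 0 = M by rewrite (fr3 12 isT) (fr2 12 isT).
apply: (runs_weaken (@runs_bucket 16 8 12 24 25 s3 (M * 50 + 20) _ _ _)) => //.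
- by move=> k; rewrite (fr3 24 isT); apply: zero2.
- by rewrite M3.
rewrite M3 (fr3 8 isT) (fr2 8 isT) (e1 8 isT) => s4 fr4 buckE.
apply: (@runs_seq _ _ _ (N * 50 + 20) (T - (M * 300 + N * 50 + 180))); last by lia.
have N4 : s4 11 0 = N by rewrite (fr4 11 isT) (fr3 11 isT) (fr2 11 isT).
apply: (runs_weaken (@runs_bucket 16 7 11 26 27 s4 (N * 50 + 20) _ _ _)) => //.
- by move=> k; rewrite (fr4 26 isT) (fr3 26 isT); apply: zero2.
- by rewrite N4.
rewrite N4 (fr4 7 isT) (fr3 7 isT) (fr2 7 isT) (e1 7 isT) => s5 fr5 buckV.
apply: (@runs_seq _ _ _ (n * 50 + 40) (T - (n * 50 + M * 300 + N * 50 + 230))); last by lia.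
have n5 : s5 10 0 = n by rewrite (fr5 10 isT) (fr4 10 isT) (fr3 10 isT) (fr2 10 isT).
apply: (runs_weaken (@runs_search_init n N (M + M) src tgt (s0 6)
  phi_lt phi_inj s5 (n * 50 + 40) _ _ _ _)) => //.
- by move=> i _; rewrite (fr5 6 isT) (fr4 6 isT) (fr3 6 isT) (fr2 6 isT) e1.
- by move=> y; rewrite (fr5 30 isT) (fr4 30 isT) (fr3 30 isT); apply: zero2.
move=> s6 fr6 [q [qok q32 q33]].
apply: (@runs_seq _ _ _ (N * 100 + M * 200 + 20)
  (T - (n * 50 + M * 500 + N * 150 + 260))); last by lia.
apply: (runs_weaken (@runs_search_loop n N (M + M) src tgt (s0 6) tgt_lt s6
  (N * 100 + M * 200 + 20) q _ _ qok q32 q33 _)) => //.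
- by move=> h _; rewrite (fr6 21 isT) (fr5 21 isT) (fr4 21 isT) (fr3 21 isT).
- by rewrite !(fr6 22 isT, fr5 22 isT, fr4 22 isT, fr6 23 isT, fr5 23 isT, fr4 23 isT).
- by lia.
move=> s7 fr7 [q7 qok7].
have e7 a : a \notin [:: 10; 11; 12; 13; 14; 15; 16; 20; 21; 22; 23; 24; 25; 26; 27;
    30; 31; 32; 33; 34; 35; 36] -> s7 a = s0 a.
  move=> an; rewrite fr7 ?fr6 ?fr5 ?fr4 ?fr3 ?fr2 ?e1 //; move: an; rewrite !inE; lia.
have lab7 := queue_labelling qok7.
have nT7 : s7 13 0 = nT by rewrite !(fr7, fr6, fr5, fr4, fr3, fr2).
have mT7 : s7 14 0 = mT by rewrite !(fr7, fr6, fr5, fr4, fr3, fr2).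
have M7 : s7 12 0 = M by rewrite !(fr7, fr6, fr5, fr4, fr3, fr2).
have HE7 : buckets (s0 8) M (s7 24) (s7 25).
  by rewrite !(fr7 24 isT, fr6 24 isT, fr5 24 isT, fr7 25 isT, fr6 25 isT, fr5 25 isT).
have HV7 : buckets (s0 7) N (s7 26) (s7 27).
  by rewrite !(fr7 26 isT, fr6 26 isT, fr7 27 isT, fr6 27 isT).
have src7 : s7 20 = src.
  by rewrite !(fr7 20 isT, fr6 20 isT, fr5 20 isT, fr4 20 isT, fr3 20 isT).
have tgt7 : s7 21 = tgt.
  by rewrite !(fr7 21 isT, fr6 21 isT, fr5 21 isT, fr4 21 isT, fr3 21 isT).
apply: (@runs_seq _ _ _ (M * 100 + mT * 100 + 50)
  (T - (n * 50 + M * 600 + mT * 100 + N * 150 + 320))); last by lia.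
apply: (runs_weaken (@runs_write_edges s0 s7 (M * 100 + mT * 100 + 50) _ _ _ _)) => //.
- by rewrite e7.
- by rewrite e7.
- by rewrite M7.
- by rewrite M7 mT7.
rewrite M7 mT7 nT7 => s8 fr8 edgs.
apply: (@runs_seq _ _ _ ((nT + M) * (K * 250 + 200) + 50) 20); last by lia.
have nT8 : s8 13 0 = nT by rewrite fr8.
apply: (runs_weaken (@runs_write_bags M N (s0 7) (s0 8) src tgt (s7 30) s8 K
  ((nT + M) * (K * 250 + 200) + 50) _ _ _ _ _ _ _ leV leE _ _ _ _)) => //.
- by rewrite fr8.
- by rewrite (fr8 8 isT) e7.
- by rewrite fr8.
- by rewrite fr8.
- by rewrite fr8.
- by rewrite (fr8 26 isT) (fr8 27 isT).
- by rewrite (fr8 24 isT) (fr8 25 isT).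
- by rewrite (fr8 41 isT) e7 // z.
- by move=> l; rewrite (fr8 40 isT) e7 // z.
- by rewrite (fr8 42 isT) e7 // z.
- by rewrite nT8.
rewrite nT8 => s9 fr9 [_ outE _]; apply: runs_run => //.
exists src, tgt, (s7 30); split=> //.
- rewrite /= /update /= (fr9 13 isT) (fr9 12 isT) (fr9 14 isT) (fr8 14 isT).
  by rewrite (fr8 12 isT) nT8 M7 mT7.
- by rewrite /= /update /= (fr9 1 isT).
Qed.

(** * Trees *)

Lemma set2_eqP (A : finType) (x y p q : A) :
  [set x; y] = [set p; q] -> (x = p /\ y = q) \/ (x = q /\ y = p).
Proof.
move=> E; have : x \in [set p; q] by rewrite -E set21.
have : y \in [set p; q] by rewrite -E set22.
have : p \in [set x; y] by rewrite E set21.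
have : q \in [set x; y] by rewrite E set22.
rewrite !inE => /orP[]/eqP ? /orP[]/eqP ? /orP[]/eqP ? /orP[]/eqP ?; subst; by [left|right].
Qed.

Section Trees.
Variable G : mgraph.
Implicit Types (x y : vertex G) (e d : edge G).

Lemma ends_pair e : exists x y, ends e = [set x; y] /\ x != y.
Proof.
have /eqP/cards2P[x [y [nxy E]]] := card_ends e.
by exists x, y.
Qed.

Lemma adj_ends e x y : ends e = [set x; y] -> adj x y.
Proof. by move=> E; apply/existsP; exists e; apply/eqP. Qed.

Lemma adj_sym x y : adj x y = adj y x.
Proof. by apply/existsP/existsP => -[e]; rewrite setUC; exists e. Qed.

Lemma connect_adj_sym : connect_sym (@adj G).
Proof. exact: (sym_connect_sym adj_sym). Qed.

(** A two-colouring whose only bichromatic edge is [e]: a certificate that [e] is a bridge, valid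
    for parallel edges too. *)
Definition cut (side : vertex G -> bool) (e : edge G) : Prop :=
  forall d x y, ends d = [set x; y] -> (side x != side y) = (d == e).

Lemma cut_ends (side : vertex G -> bool) e :
  (forall d, exists x y, ends d = [set x; y] /\ (side x != side y) = (d == e)) ->
  cut side e.
Proof.
move=> H d x y E; have [p [q [E']]] := H d.
by case: (@set2_eqP _ x y p q); rewrite -?E -?E' // => -[-> ->] //; rewrite eq_sym.
Qed.

Lemma cutN side e : cut side e -> cut (negb \o side) e.
Proof. by move=> H d x y /H <- /=; rewrite (inj_eq negb_inj). Qed.

Lemma walk_sub x p d :
  walk x p -> d \in unzip1 p -> {subset ends d <= x :: unzip2 p}.
Proof.
elim: p x => [|[e y] p IH] x //= /andP[/eqP E w]; rewrite inE => /orP[/eqP->|dp] z.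
  by rewrite E !inE => /orP[]/eqP->; rewrite eqxx ?orbT.
by move/(IH y w dp) => zp; rewrite inE zp orbT.
Qed.

(** If the first edge came back later, so would its end [x]. *)
Lemma walk_uniq x p : walk x p -> uniq (x :: unzip2 p) -> uniq (unzip1 p).
Proof.
elim: p x => [|[e y] p IH] x // /andP[/eqP E w] /andP[nx up] /=.
rewrite (IH y w up) andbT; apply/negP => ep.
by move: nx; rewrite /= (walk_sub w ep) // E set21.
Qed.

Lemma walk_of_path e x p :
  path [rel a b | [exists d, (d != e) && (ends d == [set a; b])]] x p ->
  exists q, [/\ walk x q, unzip2 q = p & e \notin unzip1 q].
Proof.
elim: p x => [|y p IH] x /=; first by exists [::].
case/andP=> /existsP[d /andP[nde E]] /IH[q [w <- eq]].
by exists ((d, y) :: q); rewrite /= E w inE negb_or eq_sym nde.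
Qed.

(** Take the component of one end of [e] once [e] is removed. Were the other end in it, a simple
    path between the two ends would close up with [e] to a cycle. *)
Lemma tree_cut e : is_tree G -> exists side, cut side e.
Proof.
case=> _ acyc; have [u [v [E nuv]]] := ends_pair e.
pose r := [rel a b | [exists d, (d != e) && (ends d == [set a; b])]].
have rs : symmetric r.
  by move=> a b; apply/existsP/existsP => -[d]; rewrite setUC; exists d.
have nc : ~~ connect r u v.
  apply/negP => /connectP[p pp lp]; case: (shortenP pp) lp => p' pp' up' _ lp'.
  have [q [w qp eq]] := walk_of_path pp'.
  have uq : uniq (unzip1 q) by apply: (walk_uniq w); rewrite qp.
  have := acyc v ((e, u) :: q); rewrite /cycle_at /= w setUC E eqxx qp -lp' eqxx eq /=.
  by rewrite uq; move: up' => /= ->.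
exists (connect r u) => d x y Ed; case: (eqVneq d e) => [Ede|nde].
  by case: (@set2_eqP _ x y u v); rewrite -?Ed ?Ede // => -[-> ->];
    rewrite connect0 (negbTE nc).
have rxy : r x y by apply/existsP; exists d; rewrite nde Ed /=.
apply/negbTE; rewrite negbK; apply/eqP; apply/idP/idP => c; apply: (connect_trans c);
  by apply: connect1; rewrite // rs.
Qed.

Lemma cut_walk side e x p :
  cut side e -> walk x p -> e \notin unzip1 p -> side (last x (unzip2 p)) = side x.
Proof.
move=> ce; elim: p x => [|[d y] p IH] x //= /andP[/eqP E w].
rewrite inE negb_or => /andP[ned ep]; rewrite (IH y) //.
by have := ce d x y E; rewrite [d == e]eq_sym (negbTE ned) => /negbFE/eqP ->.
Qed.

(** The rest of a cycle joins the ends of its first edge without using it, so no cut could separate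
    them. *)
Lemma cut_tree : connected G -> (forall e, exists side, cut side e) -> is_tree G.
Proof.
move=> cG cuts; split=> // x [|[e y] p] //; apply/negP.
case/and5P=> _ /= /andP[/eqP E w] /eqP lp /andP[ep _] _.
have [side ce] := cuts e.
by have := ce e x y E; rewrite -lp (cut_walk ce w ep) !eqxx.
Qed.

(** Root the tree at [r] and send each edge to its end on the side away from [r]: this map is
    injective and misses [r]. *)
Lemma tree_card : is_tree G -> #|edge G| < #|vertex G|.
Proof.
move=> tG; have [[/card_gt0P[r _] conn] _] := tG.
have /fin_all_exists[c cP] (e : edge G) : exists sx : {ffun vertex G -> bool} * vertex G,
    [/\ cut sx.1 e, sx.1 r = false, sx.1 sx.2 & sx.2 \in ends e].
  have [side0 ce0] := tree_cut e tG.
  have [side [ce sr]] : exists side, cut side e /\ side r = false.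
    case E: (side0 r); last by exists side0.
    by exists (negb \o side0); split; [apply: cutN|rewrite /= E].
  have [u [v [E _]]] := ends_pair e; have := ce e u v E; rewrite eqxx.
  have cf : cut [ffun x => side x] e by move=> d x y /ce; rewrite !ffunE.
  case su: (side u); case sv: (side v) => // _.
    by exists ([ffun x => side x], u); rewrite /= !ffunE E set21.
  by exists ([ffun x => side x], v); rewrite /= !ffunE E set22.
suff inj : injective (fun e => (c e).2).
  have/card_imset <- := inj; apply: (@leq_ltn_trans #|[set~ r]|).
    apply: subset_leq_card; apply/subsetP => _ /imsetP[e _ ->]; rewrite !inE.
    by have [_ cr cx _] := cP e; apply/eqP => E; rewrite E cr in cx.
  by rewrite cardsC1 ltn_predL; apply/card_gt0P; exists r.
move=> e d /= exd; apply/eqP/negPn/negP => ned.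
have [ce er ex xe] := cP e; have [cd dr dx xd] := cP d.
set x := (c e).2 in exd ex xe; rewrite -exd in dx xd.
pose S z := ~~ (c e).1 z && ~~ (c d).1 z.
(* An edge leaving S would be e or d, but these join x, which lies on the far side
   of both cuts, to a vertex on the far side of the other one. *)
have clS a b : adj a b -> S a -> S b.
  case/existsP=> g /eqP Eg /andP[/negbTE na /negbTE nb].
  have := ce g a b Eg; have := cd g a b Eg; rewrite na nb /S.
  case Db: ((c d).1 b); case Eb: ((c e).1 b) => //= /esym/eqP gd /esym/eqP ge.
  - by move: ned; rewrite -gd -ge eqxx.
  - move: xd; rewrite -gd Eg !inE => /orP[]/eqP E.
      by move: ex; rewrite E na.
    by move: ex; rewrite E Eb.
  - move: xe; rewrite -ge Eg !inE => /orP[]/eqP E.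
      by move: dx; rewrite E nb.
    by move: dx; rewrite E Db.
have : S x.
  have /connectP[p pp ->] := conn r x.
  have : S r by rewrite /S er dr.
  by elim: p r pp {er dr cP} => //= z p IH y /andP[ay pz] Sy; apply: IH => //; apply: clS Sy.
by rewrite /S ex.
Qed.
End Trees.

(** * The decomposition of the refined graph *)

Section Decomposition.
Variables (G' T : mgraph) (f : finite_morphism G' T).
Variables (src tgt : edge T -> vertex T) (low high : edge G' -> vertex G').
Variables (rank : edge G' -> nat) (prev : edge G' -> option (edge G')).
Variable top : edge T -> edge G'.
Hypothesis ends_src : forall e, ends e = [set src e; tgt e].
Hypothesis ends_low : forall e, ends e = [set low e; high e].
Hypothesis fV_low : forall e, fV f (low e) = src (fE f e).
Hypothesis fV_high : forall e, fV f (high e) = tgt (fE f e).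
Hypothesis rank_inj : injective rank.
Hypothesis prevP : forall e,
  if prev e is Some p then
    [/\ fE f p = fE f e, rank p < rank e &
        forall q, fE f q = fE f e -> rank q < rank e -> rank q <= rank p]
  else forall q, fE f q = fE f e -> rank e <= rank q.
Hypothesis topP : forall e,
  fE f (top e) = e /\ forall q, fE f q = e -> rank q <= rank (top e).

Notation node := (vertex T + edge G')%type.

(** [prev] and [top] are parameters with a specification, not functions computed from [rank],
    because they are instantiated with what the program finds in its lists. *)
Definition below (e : edge G') : node :=
  if prev e is Some p then inr p else inl (src (fE f e)).

(* The edge e of T becomes the path src e - x1 - ... - xj - tgt e through the edges
   of G' over e, in increasing rank. *)
Definition path_ends (d : edge G' + edge T) : {set node} :=
  match d with
  | inl x => [set inr x; below x]
  | inr e => [set inr (top e); inl (tgt e)]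
  end.

Lemma card_path_ends d : #|path_ends d| = 2.
Proof.
case: d => [x|e] /=; rewrite cards2 // /below.
have := prevP x; case: (prev x) => // p [_ lt _].
by case: eqP => // -[E]; rewrite E ltnn in lt.
Qed.

(** The order of the summands in both sum types fixes the numbering of the output: vertices of T
    before edges of G', and edges of G' before edges of T. *)
Definition path_tree : mgraph := MGraph card_path_ends.
Notation D := path_tree.

Lemma adj_below x : @adj D (inr x) (below x).
Proof. exact: (@adj_ends D (inl x)). Qed.

Lemma adj_top e : @adj D (inr (top e)) (inl (tgt e)).
Proof. exact: (@adj_ends D (inr e)). Qed.

Lemma edge_connect_src x : connect (@adj D) (inr x) (inl (src (fE f x))).
Proof.
have [n] := ubnP (rank x); elim: n x => // n IH x ltx.
have := prevP x; have := adj_below x; rewrite /below; case: (prev x) => [p|] ax.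
  case=> fp ltp _; apply: connect_trans (connect1 ax) _; rewrite -fp.
  by apply: IH; lia.
by move=> _; apply: connect1.
Qed.

Lemma path_tree_connected : connected T -> connected D.
Proof.
case=> /card_gt0P[r _] conn.
have symD := @connect_adj_sym D.
have st e : connect (@adj D) (inl (src e)) (inl (tgt e)).
  have [fe _] := topP e; rewrite symD.
  apply: connect_trans (_ : connect _ _ (inr (top e))) _.
    by rewrite symD connect1 // adj_top.
  by rewrite -{2}fe edge_connect_src.
have cV a b : connect (@adj T) a b -> connect (@adj D) (inl a) (inl b).
  case/connectP=> p pp ->; elim: p a pp => //= c p IH a /andP[/existsP[e /eqP E] pc].
  apply: connect_trans (IH c pc).
  by case: (@set2_eqP _ a c (src e) (tgt e)); rewrite -?E // => -[-> ->] //; rewrite symD.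
have toV (d : vertex D) : exists w, connect (@adj D) d (inl w).
  by case: d => [w|x]; [exists w|exists (src (fE f x)); apply: edge_connect_src].
split; first by apply/card_gt0P; exists (inl r).
move=> d d'; have [w c] := toV d; have [w' c'] := toV d'.
apply: connect_trans c _; apply: connect_trans (cV _ _ (conn w w')) _.
by rewrite symD.
Qed.

(** A cut of T at [e] lifts to the subdivision: the path over [e] changes side at the threshold [r],
    and the path over any other edge stays on the common side of the two ends of that edge. *)
Definition path_side (side : vertex T -> bool) (e : edge T) (r : nat) (d : node) :=
  match d with
  | inl w => side w
  | inr x => if (fE f x == e) && (r <= rank x) then side (tgt e)
             else side (src (fE f x))
  end.

Lemma path_tree_cut : is_tree T -> forall d : edge D, exists side, cut side d.
Proof.
move=> tT d.
pose e := match d with inl x => fE f x | inr e => e end.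
(* The edge below [x] is crossed when [x] is the first node moved across; the topmost edge is
   crossed when no node of the path is moved. *)
pose r := match d with inl x => rank x | inr e => (rank (top e)).+1 end.
have [side ce] := tree_cut e tT; exists (path_side side e r); apply: cut_ends => c.
have cT g : (side (src g) != side (tgt g)) = (g == e) by apply: ce.
have := cT e; rewrite eqxx => nst.
have cT' g : g != e -> side (src g) = side (tgt g).
  by have := cT g; case: (g == e) => // /negbFE/eqP.
case: c => [x|g] /=.
  exists (inr x), (below x); split=> //; rewrite /= /below.
  have := prevP x; case: (prev x) => [p [fp ltp maxp]|minx] /=.
    rewrite fp; have [fx|nfx] := eqVneq (fE f x) e; last first.
      rewrite /= eqxx; apply/esym/eqP => Ed; move: nfx.
      by rewrite /e -Ed eqxx.
    rewrite /=; transitivity ((r <= rank x) && (rank p < r)).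
      rewrite fx; case: (leqP r (rank x)); case: (leqP r (rank p)) => h1 h2 /=;
        by [rewrite eqxx|rewrite eq_sym|lia].
    case: d @e @r fx {ce cT cT' nst} => [x0|g] /= fx; last first.
      have -> : (inl x == inr g :> edge D) = false by [].
      by have [_ /(_ x fx)] := topP g; lia.
    have [Ex|nex] := eqVneq x x0; first by rewrite -Ex eqxx leqnn ltp.
    have -> : (inl x == inl x0 :> edge D) = false.
      by apply/eqP => -[E]; rewrite E eqxx in nex.
    have : rank x0 != rank x by rewrite (inj_eq rank_inj) eq_sym.
    by have := maxp x0 (esym fx); lia.
  have [fx|nfx] := eqVneq (fE f x) e; last first.
    rewrite /= eqxx; apply/esym/eqP => Ed; move: nfx.
    by rewrite /e -Ed eqxx.
  rewrite /= fx; transitivity (r <= rank x).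
    by case: leqP => _; rewrite ?eqxx // eq_sym.
  case: d @e @r fx {ce cT cT' nst} => [x0|g] /= fx; last first.
    have -> : (inl x == inr g :> edge D) = false by [].
      by have [_ /(_ x fx)] := topP g; lia.
  have [->|nex] := eqVneq x x0; first by rewrite eqxx leqnn.
  have -> : (inl x == inl x0 :> edge D) = false.
    by apply/eqP => -[E]; rewrite E eqxx in nex.
  have : rank x0 != rank x by rewrite (inj_eq rank_inj) eq_sym.
  by have := minx x0 (esym fx); lia.
exists (inr (top g)), (inl (tgt g)); split=> //=; have [fg maxg] := topP g.
rewrite fg; have [ge|nge] := eqVneq g e; last first.
  rewrite /= cT' // eqxx; apply/esym/eqP => Ed; move: nge.
  by rewrite /e -Ed eqxx.
rewrite /= -ge; transitivity (rank (top g) < r).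
  by case: leqP => _; rewrite ?eqxx // ge.
case: d @e @r ge {ce cT cT' nst} => [x0|g0] /= ge.
  have -> : (inr g == inl x0 :> edge D) = false by [].
  by have := maxg x0 (esym ge); lia.
by rewrite -ge ltnSn eqxx.
Qed.

Lemma path_tree_is_tree : is_tree T -> is_tree D.
Proof.
move=> tT; apply: cut_tree; first exact/path_tree_connected/(proj1 tT).
exact: path_tree_cut.
Qed.

Definition fine_bag (d : node) : {set vertex G'} :=
  match d with
  | inl w => [set x | fV f x == w]
  | inr e => [set low x | x in [set x | (fE f x == fE f e) && (rank e <= rank x)]] :|:
             [set high x | x in [set x | (fE f x == fE f e) && (rank x <= rank e)]]
  end.

Notation restr S := [rel a b | [&& a \in S, b \in S & @adj D a b]].

(** A low end stays in the bags while the rank decreases, hence down to its own fiber at the near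
    end; a high end stays while the rank increases, up to the far end. *)
Lemma fine_bag_connect (S : {set node}) x d :
  (forall d, x \in fine_bag d -> d \in S) -> x \in fine_bag d ->
  connect (restr S) d (inl (fV f x)).
Proof.
move=> sub; case: d => [w|e]; first by rewrite inE => /eqP <-.
have inV : inl (fV f x) \in S by apply: sub; rewrite inE.
rewrite inE => /orP[] /imsetP[y]; rewrite inE => /andP[/eqP fy le] Ex.
  have [n] := ubnP (rank e); elim: n e fy le => // n IH e fy le ltn.
  have inE' : inr e \in S.
    apply: sub; rewrite inE; apply/orP; left; apply/imsetP; exists y => //.
    by rewrite inE fy eqxx.
  have := prevP e; have := adj_below e; rewrite /below; case: (prev e) => [p|] ae.
    case=> fp ltp _; apply: connect_trans (IH p _ _ _); [|congruence|lia|lia].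
    apply: connect1; rewrite /= inE' ae andbT; apply: sub.
    rewrite inE; apply/orP; left; apply/imsetP; exists y => //.
    by rewrite inE fy fp eqxx /=; lia.
  by move=> _; apply: connect1; rewrite /= inE' inV Ex fV_low fy.
have [n] := ubnP (rank (top (fE f e)) - rank e); elim: n e fy le => // n IH e fy le ltn.
have inE' : inr e \in S.
  apply: sub; rewrite inE; apply/orP; right; apply/imsetP; exists y => //.
  by rewrite inE fy eqxx.
have [ftop maxtop] := topP (fE f e).
have [Ee|ne] := eqVneq e (top (fE f e)).
  apply: connect1; rewrite /= inE' inV Ex fV_high fy {1}Ee; exact: adj_top.
have lte : rank e < rank (top (fE f e)).
  by have := maxtop e erefl; rewrite leq_eqVlt (inj_eq rank_inj) (negbTE ne).
(* Only predecessors are given. The successor of [e] is the edge of least rank above it over the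
   same edge of T, and its predecessor must be [e]. *)
have := @arg_minnP _ (top (fE f e)) [pred q | (fE f q == fE f e) && (rank e < rank q)] rank.
rewrite /= ftop eqxx lte => /(_ isT)[q /andP[/eqP fq ltq] minq].
have := prevP q; have := adj_below q; rewrite /below; case: (prev q) => [p|] aq; last first.
  by move=> /(_ e (esym fq)); lia.
case=> fp ltp maxp.
have Epe : p = e.
  apply: rank_inj; apply/eqP; rewrite eqn_leq maxp ?andbT //.
  rewrite leqNgt; apply/negP => ltep; 
  have /minq : (fE f p == fE f e) && (rank e < rank p) by rewrite fp fq eqxx ltep.
  by lia.
apply: connect_trans (IH q _ _ _); [|congruence|lia|]; last first.
  by rewrite fq; have := maxtop q fq; lia.
apply: connect1; rewrite /= inE' (adj_sym (G := D)) -Epe aq andbT; apply: sub.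
rewrite inE; apply/orP; right; apply/imsetP; exists y => //.
by rewrite inE fy fq eqxx /=; lia.
Qed.

Section Labels.
Variables (G : mgraph) (phi : vertex G -> vertex G') (lab : vertex G' -> vertex G).
Hypothesis lab_phi : forall v, lab (phi v) = v.
Hypothesis lab_connect : forall x,
  connect [rel a b | adj a b && (lab a == lab b)] x (phi (lab x)).
Hypothesis lab_edge : forall e : edge G, exists e' : edge G', lab @: ends e' = ends e.

Definition bag (d : vertex D) : {set vertex G} := lab @: fine_bag d.

Lemma low_fine_bag e : low e \in fine_bag (inr e).
Proof. by rewrite inE; apply/orP; left; rewrite imset_f // inE eqxx /=. Qed.

Lemma high_fine_bag e : high e \in fine_bag (inr e).
Proof. by rewrite inE; apply/orP; right; rewrite imset_f // inE eqxx /=. Qed.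

Lemma ends_fine_bag e : ends e \subset fine_bag (inr e).
Proof. by rewrite ends_low subUset !sub1set low_fine_bag high_fine_bag. Qed.

(** The nodes of [v] are those of the vertices in its class. Each vertex has a connected set of
    nodes, and adjacent vertices of the class share the bag of an edge joining them, so a path in
    the class links these sets. *)
Lemma bag_tree_decomposition : is_tree T -> tree_decomposition bag.
Proof.
move=> tT; split; first exact: path_tree_is_tree.
- apply/setP => v; rewrite inE; apply/bigcupP; exists (inl (fV f (phi v))) => //.
  by apply/imsetP; exists (phi v); rewrite ?lab_phi // inE.
- move=> e; have [e' <-] := lab_edge e; exists (inr e').
  exact: imsetS (ends_fine_bag e').
move=> v; set S := [set _ | _].
have subS x d : lab x = v -> x \in fine_bag d -> d \in S.
  by move=> lx xd; rewrite /S inE -lx; apply: imset_f.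
have symS : connect_sym (restr S).
  apply: sym_connect_sym => a b /=; rewrite adj_sym.
  by case: (a \in S); case: (b \in S).
have cphi (d : vertex D) : d \in S -> connect (restr S) d (inl (fV f (phi v))).
  rewrite inE => /imsetP[x xd Ev]; have lx := esym Ev.
  apply: connect_trans (fine_bag_connect (fun d => subS x d lx) xd) _.
  have /connectP[p] := lab_connect x; rewrite lx => pp ->.
  elim: p x {d xd Ev} lx pp => //= y p IH x lx /andP[/andP[/existsP[e /eqP E] /eqP lxy] pp].
  have ly : lab y = v by rewrite -lxy.
  apply: connect_trans (IH y ly pp).
  have xe : x \in fine_bag (inr e) by rewrite (subsetP (ends_fine_bag e)) // E set21.
  have ye : y \in fine_bag (inr e) by rewrite (subsetP (ends_fine_bag e)) // E set22.
  apply: connect_trans (fine_bag_connect (fun d => subS y d ly) ye).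
  by rewrite symS; apply: (fine_bag_connect (fun d => subS x d lx) xe).
split.
  apply/set0Pn; exists (inl (fV f (phi v))); apply: (subS (phi v)) => //.
  by rewrite inE.
by move=> a b aS bS; apply: connect_trans (cphi a aS) _; rewrite symS cphi.
Qed.

(** The edges giving low ends and those giving high ends all lie in one fiber and overlap only in
    [e], so their numbers add up to at most k + 1. *)
Lemma bag_width k :
  (forall w, #|[set x | fV f x == w]| <= k) ->
  (forall e, #|[set x | fE f x == e]| <= k) -> width bag <= k.
Proof.
move=> leV leE; rewrite /width -ltnS.
suff : \max_i #|bag i| <= k.+1 by lia.
apply/bigmax_leqP => -[w|e] _; apply: leq_trans (leq_imset_card _ _) _ => /=.
  exact: leq_trans (leV w) _.
set A := [set x | _ && (rank e <= _)]; set B := [set x | _ && (_ <= rank e)].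
apply: leq_trans (leq_card_setU _ _) _.
apply: leq_trans (leq_add (leq_imset_card _ _) (leq_imset_card _ _)) _.
rewrite -cardsUI -addn1 leq_add //.
  apply: leq_trans (subset_leq_card _) (leE (fE f e)).
  by apply/subsetP => x; rewrite !inE => /orP[]/andP[].
rewrite -(cards1 e); apply: subset_leq_card; apply/subsetP => x.
rewrite !inE => /andP[/andP[_ le] /andP[_ ge]].
by rewrite -(inj_eq rank_inj) eqn_leq le ge.
Qed.
End Labels.
End Decomposition.

(** * Refinements and degrees *)

Lemma connect_homo (A B : finType) (r : rel A) (r' : rel B) (h : A -> B) :
  (forall a b, r a b -> connect r' (h a) (h b)) ->
  forall a b, connect r a b -> connect r' (h a) (h b).
Proof.
move=> H a b /connectP[p pp ->]; elim: p a pp => //= c p IH a /andP[rac pc].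
exact: connect_trans (H _ _ rac) (IH c pc).
Qed.

Notation same_label lab := [rel a b | adj a b && (lab a == lab b)].

(** All that is retained of the search: a retraction of [phi] with connected fibers, hence a
    partition of V(G') into classes that could be contracted. *)
Definition valid_labels (G G' : mgraph) (phi : vertex G -> vertex G')
    (lab : vertex G' -> vertex G) : Prop :=
  (forall v, lab (phi v) = v) /\
  forall x, connect (same_label lab) x (phi (lab x)).

(** Undoes one operation: [r] moves a new vertex onto a neighbour, and edges inside a class must
    become walks inside the class. *)
Lemma valid_labels_retract (G G1 G2 : mgraph) (phi : vertex G -> vertex G1)
    (i : vertex G1 -> vertex G2) (r : vertex G2 -> vertex G1)
    (lab : vertex G2 -> vertex G) :
  (forall x, r (i x) = x) ->
  (forall a b, adj a b -> lab a = lab b ->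
     connect (same_label (lab \o i)) (r a) (r b)) ->
  valid_labels (i \o phi) lab -> valid_labels phi (lab \o i).
Proof.
move=> ri H [lab_phi conn]; split=> // x.
rewrite -{1}(ri x) -(ri (phi _)); apply: (connect_homo _ (conn (i x))) => a b.
by case/andP=> ab /eqP; apply: H.
Qed.

Section SubdivideAdj.
Variables (G : mgraph) (e : edge G).

Lemma subdivide_adj_Some x y : @adj (subdivide e) (Some x) (Some y) -> adj x y.
Proof.
case/existsP=> -[[d nd]|[z ze]] /eqP /= E; last first.
  have : None \in [set Some x; Some y] by rewrite -E set22.
  by rewrite !inE.
apply: (@adj_ends _ d); apply: (imset_inj (@Some_inj _)).
by rewrite E imsetU !imset_set1.
Qed.

Lemma subdivide_adj_None x : @adj (subdivide e) (Some x) None -> x \in ends e.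
Proof.
case/existsP=> -[[d nd]|[z ze]] /eqP /= E.
  have : None \in [set Some x; None] by rewrite set22.
  by rewrite -E => /imsetP[].
by case: (set2_eqP E) => -[] // [<-].
Qed.

Lemma adj_None_subdivide x : x \in ends e -> @adj (subdivide e) (Some x) None.
Proof. by move=> xe; apply: (@adj_ends (subdivide e) (inr (exist _ x xe))). Qed.

Lemma subdivide_loopless : @adj (subdivide e) None None = false.
Proof.
apply/negbTE/negP => /existsP[d /eqP E]; have := card_ends d.
by rewrite E setUid cards1.
Qed.
End SubdivideAdj.

Section AddLeafAdj.
Variables (G : mgraph) (v : vertex G).

Lemma add_leaf_adj_Some x y : @adj (add_leaf v) (Some x) (Some y) -> adj x y.
Proof.
case/existsP=> -[d|] /eqP /= E; last first.
  have : None \in [set Some x; Some y] by rewrite -E set22.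
  by rewrite !inE.
apply: (@adj_ends _ d); apply: (imset_inj (@Some_inj _)).
by rewrite E imsetU !imset_set1.
Qed.

Lemma add_leaf_adj_None x : @adj (add_leaf v) (Some x) None -> x = v.
Proof.
case/existsP=> -[d|] /eqP /= E.
  have : None \in [set Some x; None] by rewrite set22.
  by rewrite -E => /imsetP[].
by case: (set2_eqP E) => -[] // [<-].
Qed.

Lemma add_leaf_loopless : @adj (add_leaf v) None None = false.
Proof.
apply/negbTE/negP => /existsP[d /eqP E]; have := card_ends d.
by rewrite E setUid cards1.
Qed.
End AddLeafAdj.

Lemma connect_step (A : finType) (r : rel A) (a b : A) :
  connect r a b -> a != b -> exists c, r a c.
Proof.
case/connectP=> -[|c p] /=; first by move=> _ ->; rewrite eqxx.
by case/andP=> rac _ _ _; exists c.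
Qed.

(** Induction peels off the last operation. Quantifying over all valid labels lets the hypothesis
    apply to the labels restricted to the smaller graph. *)
Lemma refinement_label_edge (G G' : mgraph) (phi : vertex G -> vertex G') :
  refinement phi -> forall lab, valid_labels phi lab ->
  forall e : edge G, exists e' : edge G', lab @: ends e' = ends e.
Proof.
elim=> {G' phi} [|G1 G2 phi g h _ IH [g' gK g'K] [h' hK h'K] endsh
  |G1 phi e1 _ IH|G1 phi v _ IH] lab vl e.
- exists e; have [lab_id _] := vl; rewrite -[RHS]imset_id.
  by apply: eq_imset => x; apply: lab_id.
- have [|e' E] := IH (lab \o g) _ e.
    apply: (@valid_labels_retract _ _ _ phi g g') vl => // a b /existsP[d /eqP E] lab_ab.
    apply: connect1; rewrite /= !g'K lab_ab eqxx andbT; apply: (@adj_ends _ (h' d)).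
    apply: (imset_inj (can_inj gK)).
    by rewrite -endsh h'K E imsetU !imset_set1 !g'K.
  by exists (h e'); rewrite endsh -imset_comp.
- have [lab_phi conn] := vl.
  (* The new vertex is not in the image of G, so its connected class contains a neighbour [x0], an
     end of the subdivided edge. *)
  have [[x0|] /= /andP[a0 /eqP l0]] := connect_step (conn None) isT; last first.
    by rewrite subdivide_loopless in a0.
  have x0e : x0 \in ends e1 by apply: subdivide_adj_None; rewrite adj_sym.
  have [|e' E] := IH (lab \o Some) _ e.
    apply: (@valid_labels_retract _ _ (subdivide e1) phi Some (odflt x0)) vl => //.
    have step x : x \in ends e1 -> lab (Some x) = lab (Some x0) ->
        connect (same_label (lab \o Some)) x x0.
      have [->|nx] := eqVneq x x0; first by rewrite connect0.
      move=> xe lx; apply: connect1; rewrite /= lx eqxx andbT; apply: (@adj_ends _ e1).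
      apply/eqP; rewrite eq_sym eqEcard card_ends cards2 nx andbT.
      by rewrite subUset !sub1set xe x0e.
    have sym : connect_sym (same_label (lab \o Some) : rel (vertex G1)).
      by apply: sym_connect_sym => a b /=; rewrite adj_sym eq_sym.
    move=> [a|] [b|] //= ab lab_ab.
    + by apply: connect1; rewrite /= (subdivide_adj_Some ab) lab_ab eqxx.
    + by apply: step; [apply: subdivide_adj_None|rewrite lab_ab].
    + by rewrite sym; apply: step;
        [apply: subdivide_adj_None; rewrite adj_sym|rewrite -lab_ab].
  (* Any other edge survives the subdivision. If [e1] itself represented [e], its half at the end
     opposite to [x0] does so now, as the new vertex carries the label of [x0]. *)
  have [Ee|ne] := eqVneq e' e1; last first.
    by exists (inl (exist _ e' ne)); rewrite /= -imset_comp.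
  have [a [b [Eab nab]]] := ends_pair e1.
  have [y0 y0e Ee1] : exists2 y0, y0 \in ends e1 & ends e1 = [set y0; x0].
    move: x0e; rewrite Eab !inE => /orP[]/eqP->; [exists b|exists a] => //.
    - by rewrite set22.
    - by rewrite setUC.
    - by rewrite set21.
  exists (inr (exist _ y0 y0e)); rewrite /= -E Ee Ee1 !imsetU !imset_set1 /=.
  by rewrite l0.
- have [lab_phi conn] := vl.
  have [[x0|] /= /andP[a0 /eqP l0]] := connect_step (conn None) isT; last first.
    by rewrite add_leaf_loopless in a0.
  have x0v : x0 = v by apply: add_leaf_adj_None; rewrite adj_sym.
  have [|e' E] := IH (lab \o Some) _ e; last by exists (Some e'); rewrite /= -imset_comp.
  apply: (@valid_labels_retract _ _ (add_leaf v) phi Some (odflt v)) vl => //.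
  move=> [a|] [b|] //= ab lab_ab.
  + by apply: connect1; rewrite /= (add_leaf_adj_Some ab) lab_ab eqxx.
  + by rewrite (add_leaf_adj_None ab) connect0.
  + by rewrite adj_sym in ab; rewrite (add_leaf_adj_None ab) connect0.
Qed.

Lemma refinement_inj (G G' : mgraph) (phi : vertex G -> vertex G') :
  refinement phi -> injective phi.
Proof.
elim=> {G' phi} [|G1 G2 phi g h _ IH /bij_inj gI _ _|G1 phi e _ IH|G1 phi v _ IH] //.
- exact: inj_comp.
- by apply: inj_comp => //; apply: Some_inj.
- by apply: inj_comp => //; apply: Some_inj.
Qed.

Lemma refinement_connected (G G' : mgraph) (phi : vertex G -> vertex G') :
  refinement phi -> connected G -> connected G'.
Proof.
move=> + cG; elim=> {G' phi} [|G1 G2 phi g h _ [n0 IH] [g' gK g'K] _ endsh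
  |G1 phi e _ [n0 IH]|G1 phi v _ [n0 IH]] //.
- split; first by case/card_gt0P: n0 => x _; apply/card_gt0P; exists (g x).
  move=> x y; rewrite -(g'K x) -(g'K y); apply: (connect_homo _ (IH _ _)) => a b.
  case/existsP=> d /eqP E; apply: connect1; apply: (@adj_ends _ (h d)).
  by rewrite endsh E imsetU !imset_set1.
- have symD := @connect_adj_sym (subdivide e).
  have cS x y : connect (@adj (subdivide e)) (Some x) (Some y).
    apply: (connect_homo (h := Some) _ (IH x y)) => a b /existsP[d /eqP E].
    have [Ed|nd] := eqVneq d e.
      apply: (@connect_trans _ _ None).
        by rewrite connect1 // adj_None_subdivide // -Ed E set21.
      by rewrite symD connect1 // adj_None_subdivide // -Ed E set22.
    apply: connect1; apply: (@adj_ends (subdivide e) (inl (exist _ d nd))).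
    by rewrite /= E imsetU !imset_set1.
  have [a [b [E _]]] := ends_pair e.
  have cN : connect (@adj (subdivide e)) None (Some a).
    by rewrite symD connect1 // adj_None_subdivide // E set21.
  split; first by apply/card_gt0P; exists None.
  have toa (x : option (vertex G1)) : connect (@adj (subdivide e)) x (Some a) by case: x.
  by move=> x y; apply: connect_trans (toa x) _; rewrite symD.
- have symD := @connect_adj_sym (add_leaf v).
  have cN : connect (@adj (add_leaf v)) None (Some v).
    by rewrite symD connect1 //; apply: (@adj_ends (add_leaf v) None).
  have cS x y : connect (@adj (add_leaf v)) (Some x) (Some y).
    apply: (connect_homo (h := Some) _ (IH x y)) => a b /existsP[d /eqP E].
    apply: connect1; apply: (@adj_ends (add_leaf v) (Some d)).
    by rewrite /= E imsetU !imset_set1.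
  split; first by apply/card_gt0P; exists None.
  have toa (x : option (vertex G1)) : connect (@adj (add_leaf v)) x (Some v) by case: x.
  by move=> x y; apply: connect_trans (toa x) _; rewrite symD.
Qed.

(** * Fibers of a harmonic morphism *)

Section Degree.
Variables (G T : mgraph) (f : finite_morphism G T) (k : nat).
Hypothesis connG : connected G.
Hypothesis degf : harmonic_of_degree f k.

Lemma degree_gt0 : 0 < k.
Proof.
have [/card_gt0P[e _] [m [_ _ sumE]]] := degf.
by rewrite -(sumE (fE f e)) (bigD1 e) //= addn_gt0 edge_index_gt0.
Qed.

Lemma card_edge_fiber e : #|[set x | fE f x == e]| <= k.
Proof.
have [_ [m [_ _ sumE]]] := degf; rewrite -(sumE e) -sum1_card.
rewrite (eq_bigl (fun x => fE f x == e)) => [|x]; last by rewrite inE.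
by apply: leq_sum => x _; apply: edge_index_gt0.
Qed.

Lemma edge_fiber_neq0 e : exists x, fE f x = e.
Proof.
have [_ [m [_ _ sumE]]] := degf; have := degree_gt0; rewrite -(sumE e).
have [x /eqP fx _|none] := pickP [pred x | fE f x == e]; first by exists x.
by rewrite big_pred0.
Qed.

Lemma vertex_edge x : exists e : edge G, x \in ends e.
Proof.
have [/card_gt0P[e _] _] := degf; have [a [b [E nab]]] := ends_pair e.
have [y nxy] : exists y, x != y.
  by have [xa|] := eqVneq x a; [exists b; rewrite xa|exists a].
have [z /existsP[d /eqP Ed]] := connect_step (connG.2 x y) nxy.
by exists d; rewrite Ed set21.
Qed.

(** By connectedness every [x] has an incident edge, and harmonicity at the image of that edge
    forces [m x] to be positive. *)
Lemma card_vertex_fiber w : #|[set x | fV f x == w]| <= k.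
Proof.
have [_ [m [harm sumV _]]] := degf; rewrite -(sumV w) -sum1_card.
rewrite (eq_bigl (fun x => fV f x == w)) => [|x]; last by rewrite inE.
apply: leq_sum => x _; have [e xe] := vertex_edge x.
rewrite -(harm x (fE f e)); last by rewrite ends_fE imset_f.
by rewrite (bigD1 e) /= ?xe ?eqxx // addn_gt0 edge_index_gt0.
Qed.

(** A positive degree leaves no fiber empty, so [f] is onto. *)
Lemma card_target_vertex : #|vertex T| <= #|vertex G|.
Proof.
have [_ [m [_ sumV _]]] := degf.
have sur w : exists x, fV f x == w.
  have := degree_gt0; rewrite -(sumV w).
  have [x fx _|none] := pickP [pred x | fV f x == w]; first by exists x.
  by rewrite big_pred0.
rewrite -[#|vertex T|]cardsT; have <- : fV f @: [set: vertex G] = [set: vertex T].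
  by apply/setP => w; rewrite inE; have [x /eqP <-] := sur w; rewrite imset_f.
by rewrite -[#|vertex G|]cardsT; apply: leq_imset_card.
Qed.

Lemma card_source_edge : #|edge G| <= k * #|edge T|.
Proof.
rewrite -sum1_card (partition_big (fE f) xpredT) //= mulnC -sum_nat_const.
apply: leq_sum => e _; apply: leq_trans (card_edge_fiber e).
by rewrite -sum1_card leq_eqVlt; apply/orP; left; apply/eqP/eq_bigl => x; rewrite inE.
Qed.
End Degree.

(** * Encodings *)

Section Codes.
Variable A : finType.
Implicit Type x : A.

Lemma code_lt x : code x < #|A|.
Proof. exact: ltn_ord. Qed.

Lemma code_inj : injective (@code A).
Proof. by move=> x y /val_inj/enum_rank_inj. Qed.

Lemma codeP i : i < #|A| -> exists x, code x = i.
Proof. by move=> lt; exists (enum_val (Ordinal lt)); rewrite /code enum_valK. Qed.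

Lemma nth_enum_code (B : Type) (b : B) (F : A -> B) x :
  nth b [seq F y | y <- enum A] (code x) = F x.
Proof.
by rewrite (nth_map x) ?nth_enum_rank // -cardE ltn_ord.
Qed.

Lemma map_code_enum : [seq code x | x <- enum A] = iota 0 #|A|.
Proof.
apply: (@eq_from_nth _ 0) => [|i]; first by rewrite size_map size_iota -cardE.
rewrite size_map -cardE => /[dup] lti /codeP[x <-].
by rewrite nth_enum_code nth_iota // code_lt.
Qed.

Lemma map_enum_code (B : Type) (F : nat -> B) :
  [seq F (code x) | x <- enum A] = [seq F i | i <- iota 0 #|A|].
Proof. by rewrite -map_code_enum -map_comp. Qed.

Lemma lists_pair x y : x != y -> lists [:: code x; code y] [set x; y].
Proof.
move=> nxy; apply: uniq_perm.
- by rewrite /= inE (inj_eq code_inj) nxy.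
- by rewrite (map_inj_uniq code_inj) enum_uniq.
move=> j; rewrite !inE; apply/orP/mapP => [[]/eqP->|[z]].
- by exists x; rewrite // mem_enum set21.
- by exists y; rewrite // mem_enum set22.
by rewrite mem_enum !inE => /orP[]/eqP-> ->; rewrite eqxx; [left|right].
Qed.

Lemma lists_set2 s (S : {set A}) : lists s S -> #|S| = 2 ->
  exists p : A * A, s = [:: code p.1; code p.2] /\ S = [set p.1; p.2].
Proof.
move=> ls S2; have := perm_size ls; rewrite size_map -cardE S2.
have us : uniq s by rewrite (perm_uniq ls) (map_inj_uniq code_inj) enum_uniq.
have mem_s j : j \in s -> exists2 x, x \in S & j = code x.
  by rewrite (perm_mem ls) => /mapP[x]; rewrite mem_enum; exists x.
case: s us mem_s {ls} => [|a [|b [|c s]]] //= us mem_s _.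
have [x xS Ea] := mem_s a (mem_head _ _).
have [|y yS Eb] := mem_s b; first by rewrite !inE eqxx orbT.
exists (x, y); rewrite Ea Eb; split=> //=; apply/eqP; rewrite eq_sym eqEcard S2.
move: us; rewrite /= inE Ea Eb (inj_eq code_inj) andbT => nxy.
by rewrite cards2 nxy subUset !sub1set xS yS.
Qed.

End Codes.

Lemma size_chain_le (A B : finType) (F : A -> B) K k j :
  (forall x, K (code x) = code (F x)) ->
  (forall b, #|[set x | F x == b]| <= k) -> size (chain K #|A| j) <= k.
Proof.
move=> KE lek; case E: (chain K #|A| j) => [|i l] //; rewrite -E.
have : i \in chain K #|A| j by rewrite E mem_head.
rewrite mem_chain => /andP[/codeP[x <-] /eqP]; rewrite KE => <-.
apply: leq_trans (lek (F x)); rewrite cardE -(size_map (@code A)).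
apply: uniq_leq_size; first by rewrite rev_uniq filter_uniq // iota_uniq.
move=> y; rewrite mem_chain => /andP[/codeP[z <-] /eqP]; rewrite KE => /code_inj Fz.
by apply: map_f; rewrite mem_enum inE Fz.
Qed.

Section SumCodes.
Variables A B : finType.

Lemma enum_sum : enum {: A + B} = [seq inl x | x <- enum A] ++ [seq inr y | y <- enum B].
Proof. by rewrite !enumT [in LHS]unlock. Qed.

Lemma index_code (C : finType) (x : C) : index x (enum C) = code x.
Proof.
by rewrite -{1}[x](nth_enum_rank x) index_uniq ?enum_uniq // -cardE ltn_ord.
Qed.

Lemma code_inl (x : A) : code (inl x : A + B) = code x.
Proof.
rewrite -!index_code enum_sum index_cat map_f ?mem_enum //.
by rewrite index_map //; apply: inl_inj.
Qed.

Lemma code_inr (y : B) : code (inr y : A + B) = #|A| + code y.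
Proof.
rewrite -!index_code enum_sum index_cat ifN; last by apply/negP => /mapP[].
by rewrite size_map -cardE index_map //; apply: inr_inj.
Qed.
End SumCodes.

(** * Reading the arrays back as graphs *)

Lemma nth_flatten2 (ss : seq (seq nat)) i j :
  all (fun s => size s == 2) ss -> j < 2 ->
  nth 0 (flatten ss) (i + i + j) = nth 0 (nth [::] ss i) j.
Proof.
elim: ss i => [|s ss IH] i /=; first by rewrite !nth_nil.
case/andP=> /eqP s2 /IH{}IH ltj; rewrite nth_cat s2; case: i => [|i] /=.
  by rewrite ltj.
have -> : (i.+1 + i.+1 + j < 2) = false by lia.
have -> : i.+1 + i.+1 + j - 2 = i + i + j by lia.
exact: IH.
Qed.

(** Used twice: with [n] the number of an edge of G' it gives its predecessor on the path, and with
    [n] the number of all edges it gives the last node of a path. *)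
Lemma chain_head K n k :
  if chain K n k is p :: _ then
    [/\ p < n, K p = k & forall q, q < n -> K q = k -> q <= p]
  else forall q, q < n -> K q <> k.
Proof.
elim: n => [|n IH] //; rewrite chainS; case: eqP => [Kn|nKn]; first by split=> // q; lia.
case: (chain K n k) IH => [|p l] /= IH.
  by move=> q; rewrite ltnS leq_eqVlt => /orP[/eqP->|/IH].
have [ltp Kp maxp] := IH; split=> //; first by lia.
by move=> q; rewrite ltnS leq_eqVlt => /orP[/eqP->|/maxp].
Qed.

Lemma mem_edge_emits i x src tgt j :
  (j \in edge_emits src tgt i x) =
  (i <= x) && (j == src x) || (x <= i) && (j == tgt x).
Proof. by rewrite mem_cat; case: (i <= x); case: (x <= i); rewrite ?inE ?in_nil. Qed.

Lemma size_flatten2 (ss : seq (seq nat)) :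
  all (fun s => size s == 2) ss -> size (flatten ss) = size ss + size ss.
Proof.
elim: ss => //= s ss IH /andP[/eqP s2 /IH{}IH]; rewrite size_cat s2 IH; lia.
Qed.

(** An encoding lists the ends of an edge in either order; [p] records the order that was chosen. *)
Lemma load_ends (G : mgraph) (s : edge G -> seq nat) :
  (forall e, lists (s e) (ends e)) ->
  exists p : edge G -> vertex G * vertex G,
    (forall e, ends e = [set (p e).1; (p e).2]) /\
    let a := nth 0 (flatten [seq s e | e <- enum (edge G)]) in
    forall e, a (code e + code e) = code (p e).1 /\
              a (code e + code e + 1) = code (p e).2.
Proof.
move=> ls; have /fin_all_exists[p pP] e := lists_set2 (ls e) (card_ends e).
exists p; split=> [e|/= e]; first exact: (pP e).2.
have all2 : all (fun s => size s == 2) [seq s e | e <- enum (edge G)].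
  by apply/allP => _ /mapP[d _ ->]; rewrite (pP d).1.
have nthE j : j < 2 ->
    nth 0 (flatten [seq s e | e <- enum (edge G)]) (code e + code e + j) = nth 0 (s e) j.
  by move=> ltj; rewrite nth_flatten2 // nth_enum_code.
by rewrite -[code e + code e in X in X /\ _]addn0 !nthE // (pP e).1.
Qed.

(** Labels spread along half-edges from some phi(v), so connectedness of G' labels every vertex.
    Going back to parents keeps the label and lowers [rk], which produces the path inside the
    class. *)
Lemma labelling_valid (G G' : mgraph) (phi : vertex G -> vertex G')
    (M2 : nat) (src tgt rho L : nat -> nat) :
  connected G -> connected G' ->
  (forall v, rho (code v) = code (phi v)) ->
  (forall a b : vertex G', adj a b <->
     exists2 h, h < M2 & src h = code a /\ tgt h = code b) ->
  (forall h, h < M2 -> exists a : vertex G', src h = code a) ->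
  labelling #|vertex G| M2 src tgt rho L ->
  exists2 lab, valid_labels phi lab & forall x, L (code x) = (code (lab x)).+1.
Proof.
move=> [/card_gt0P[v0 _] _] [_ conn'] rhoE adjE srcP [rk [Lphi Lcl Lpar]].
have Lphi' v : L (code (phi v)) = (code v).+1 by rewrite -rhoE Lphi ?code_lt.
have L0 (x : vertex G') : L (code x) != 0.
  have /connectP[p pp ->] := conn' (phi v0) x.
  have : L (code (phi v0)) != 0 by rewrite Lphi'.
  elim: p (phi v0) pp => //= y p IH z /andP[/adjE[h lth [sh th]] py] Lz.
  by apply: IH => //; rewrite -th; apply: Lcl => //; rewrite sh.
pose r := [rel a b : vertex G' | adj a b && (L (code a) == L (code b))].
have rs : connect_sym r by apply: sym_connect_sym => a b /=; rewrite adj_sym eq_sym.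
have Lv (x : vertex G') : exists v, L (code x) = (code v).+1 /\ connect r x (phi v).
  have [n] := ubnP (rk (code x)); elim: n x => // n IH x ltn.
  case: (Lpar _ (L0 x)) => [[i lti Ei]|[h lth [th Lh rkh]]].
    have [v Ev] := codeP lti; exists v.
    have -> : x = phi v by apply: code_inj; rewrite Ei -Ev rhoE.
    by rewrite Lphi' connect0.
  have [a sh] := srcP h lth; rewrite sh in Lh rkh.
  have [|v [Lav cav]] := IH a; first by lia.
  exists v; rewrite -Lh Lav; split=> //; apply: connect_trans cav.
  rewrite rs; apply: connect1; rewrite /= Lh eqxx andbT; apply/adjE.
  by exists h.
have /fin_all_exists[lab labP] := Lv.
exists lab => [|x]; last by case: (labP x).
split=> [v|x].
  by have [+ _] := labP (phi v); rewrite Lphi' => -[] /code_inj.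
have [_] := labP x; apply: connect_sub => a b /andP[ab Lab]; apply: connect1.
rewrite /= ab /=; move: Lab; rewrite (labP a).1 (labP b).1 eqSS.
by rewrite (inj_eq (@code_inj _)).
Qed.

Lemma lists_bag_labels (G G' : mgraph) (lab : vertex G' -> vertex G) L
    (em : nat -> seq nat) l (S : {set vertex G'}) :
  (forall x, L (code x) = (code (lab x)).+1) ->
  (forall j, j \in flatten [seq em i | i <- l] <-> exists2 x, x \in S & j = code x) ->
  lists (map predn (bag_labels em L l)) (lab @: S).
Proof.
move=> LE emS; apply: uniq_perm.
- rewrite map_inj_in_uniq ?uniq_foldl_add_new // => a b.
  rewrite !mem_foldl_add_new /= => /mapP[j /emS[x _ ->] ->] /mapP[j' /emS[y _ ->] ->].
  by rewrite !LE /= => ->.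
- by rewrite (map_inj_uniq (@code_inj _)) enum_uniq.
move=> c; apply/mapP/mapP => [[a]|[v]].
  rewrite mem_foldl_add_new /= => /mapP[j /emS[x xS ->] ->] ->.
  by exists (lab x); rewrite ?LE // mem_enum imset_f.
rewrite mem_enum => /imsetP[x xS ->] ->; exists (L (code x)); last by rewrite LE.
by rewrite mem_foldl_add_new /= map_f //; apply/emS; exists x.
Qed.

Lemma decompose_correct (G G' T : mgraph) (phi : vertex G -> vertex G')
    (f : finite_morphism G' T) (k : nat) (input : seq (seq nat)) :
  connected G -> refinement phi -> is_tree T -> harmonic_of_degree f k ->
  codes_instance phi f input ->
  exists (s : store) (t : nat) (D : mgraph)
    (X : vertex D -> {set vertex G}) (output : seq (seq nat)),
    [/\ exec decompose (load input) s t,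
        t <= 3000 * (k ^ 2 * #|vertex G'|),
        tree_decomposition X /\ width X <= k &
        codes_tree_decomposition X output /\ holds s output].
Proof.
move=> cG refi tT degf [_ [_ [_ [[sG _ ->] [sG' lG' ->] [sT lT ->] Einput]]]].
set s0 := load input.
have cG' := refinement_connected refi cG.
have [p [endsp pE]] := load_ends lG'; have [q [endsq qE]] := load_ends lT.
have e3 e : s0 3 (code e + code e) = code (p e).1 /\
    s0 3 (code e + code e + 1) = code (p e).2 by rewrite /s0 Einput; apply: pE.
have e5 e : s0 5 (code e + code e) = code (q e).1 /\
    s0 5 (code e + code e + 1) = code (q e).2 by rewrite /s0 Einput; apply: qE.
have e6 v : s0 6 (code v) = code (phi v).
  by rewrite /s0 Einput /load /= /code_fun nth_enum_code.
have e7 x : s0 7 (code x) = code (fV f x).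
  by rewrite /s0 Einput /load /= /code_fun nth_enum_code.
have e8 x : s0 8 (code x) = code (fE f x).
  by rewrite /s0 Einput /load /= /code_fun nth_enum_code.
have z a i : 10 <= a -> s0 a i = 0.
  by rewrite /s0 Einput /load; do 10 (case: a => [|a] //); rewrite /= !nth_nil.
have e00 : s0 0 0 = #|vertex G| by rewrite /s0 Einput.
have e20 : s0 2 0 = #|vertex G'| by rewrite /s0 Einput.
have e21 : s0 2 1 = #|edge G'| by rewrite /s0 Einput.
have e40 : s0 4 0 = #|vertex T| by rewrite /s0 Einput.
have e41 : s0 4 1 = #|edge T| by rewrite /s0 Einput.
move: s0 e3 e5 e6 e7 e8 z e00 e20 e21 e40 e41 {Einput pE qE}
  => s0 e3 e5 e6 e7 e8 z e00 e20 e21 e40 e41.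
have lt3 i : i < #|edge G'| + #|edge G'| -> s0 3 i < #|vertex G'|.
  move=> lti; have [|e Ee] := @codeP (edge G') i./2; first by lia.
  have : i = code e + code e \/ i = code e + code e + 1 by lia.
  by case=> ->; rewrite ?(e3 e).1 ?(e3 e).2 code_lt.
have lt6 i : i < #|vertex G| -> s0 6 i < #|vertex G'|.
  by case/codeP=> v <-; rewrite e6 code_lt.
have inj6 i j : i < #|vertex G| -> j < #|vertex G| -> s0 6 i = s0 6 j -> i = j.
  case/codeP=> v <- /codeP[u <-]; rewrite !e6.
  by move/code_inj/(refinement_inj refi) ->.
have leV j : size (chain (s0 7) #|vertex G'| j) <= k.
  by apply: (size_chain_le _ e7); apply: card_vertex_fiber.
have leE j : size (chain (s0 8) #|edge G'| j) <= k.
  by apply: (size_chain_le _ e8); apply: card_edge_fiber.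
pose Tm := 3000 * (k ^ 2 * #|vertex G'|).
have [|s [t [ex let_t [src [tgt [L [ori labL [s00 s01] edgs bgs]]]]]]] :=
  runs_decompose (T := Tm) z e00 e20 e21 e40 e41 lt3 lt6 inj6 leV leE.
  (* There are at most 2k|V(G')| bags at cost at most 450k each, that is 900k^2|V(G')| in all. The
     other terms add at most 1400k^2|V(G')|, so 3000 is ample. *)
  have k0 := degree_gt0 degf; have leT := card_target_vertex degf.
  have leM := card_source_edge degf; have ltT := tree_card tT.
  have len : #|vertex G| <= #|vertex G'| := leq_card phi (refinement_inj refi).
  rewrite /Tm -mulnn; set N := #|vertex G'| in leT len *; set M := #|edge G'| in leM *.
  have leMN : M <= k * N by apply: leq_trans leM _; rewrite leq_mul2l; lia.
  have le1 : N <= k * k * N by rewrite -{1}[N]mul1n leq_mul2r muln_gt0 k0 orbT.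
  have le2 : k * N <= k * k * N by rewrite -mulnA leq_pmull.
  have le3 : (#|vertex T| + M) * (k * 250 + 200) <= (2 * (k * N)) * (450 * k).
    apply: leq_mul; last by lia.
    by have : N <= k * N by [rewrite leq_pmull]; lia.
  have E3 : (2 * (k * N)) * (450 * k) = 900 * (k * k * N) by nia.
  by lia.
pose gsrc e := (q e).1; pose gtgt e := (q e).2.
pose ok e := fV f (p e).1 == gsrc (fE f e).
pose glow e := if ok e then (p e).1 else (p e).2.
pose ghigh e := if ok e then (p e).2 else (p e).1.
have okE e : matches s0 (code e) = ok e.
  by rewrite /matches (e3 e).1 e7 e8 (e5 _).1 (inj_eq (@code_inj _)).
have lowE e : low s0 (code e) = code (glow e).
  by rewrite /low okE /glow; case: (ok e); rewrite /= ?addn0 ?(e3 e).1 ?(e3 e).2.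
have highE e : high s0 (code e) = code (ghigh e).
  by rewrite /high okE /ghigh; case: (ok e); rewrite /= ?addn0 ?(e3 e).1 ?(e3 e).2.
have ends_src e : ends e = [set gsrc e; gtgt e] by exact: endsq.
have ends_low e : ends e = [set glow e; ghigh e].
  by rewrite /glow /ghigh endsp; case: (ok e) => //; rewrite setUC.
have fVp e : fV f (glow e) = gsrc (fE f e) /\ fV f (ghigh e) = gtgt (fE f e).
  have := ends_fE f e; rewrite endsp imsetU !imset_set1 ends_src => E.
  rewrite /glow /ghigh /ok; case: (set2_eqP E) => -[E1 E2].
    by rewrite -E1 eqxx E1 E2.
  by case: eqP => [E3|_]; split; congruence.
have srcE e : src (code e) = code (glow e) by have [-> _ _ _] := ori _ (code_lt e).
have tgtE e : tgt (code e) = code (ghigh e) by have [_ -> _ _] := ori _ (code_lt e).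
have srcE' e : src (#|edge G'| + code e) = code (ghigh e).
  by have [_ _ -> _] := ori _ (code_lt e).
have tgtE' e : tgt (#|edge G'| + code e) = code (glow e).
  by have [_ _ _ ->] := ori _ (code_lt e).
have halfE h : h < #|edge G'| + #|edge G'| -> exists a b : vertex G',
    [/\ src h = code a, tgt h = code b & adj a b].
  move=> lth; have [/codeP[e <-]|ge] := ltnP h #|edge G'|.
    by exists (glow e), (ghigh e); split=> //; apply: (@adj_ends _ e).
  have [|e Ee] := @codeP (edge G') (h - #|edge G'|); first by lia.
  have -> : h = #|edge G'| + code e by lia.
  exists (ghigh e), (glow e); split=> //; apply: (@adj_ends _ e).
  by rewrite setUC.
have [||lab vlab labE] := labelling_valid cG cG' e6 _ _ labL.
- move=> a b; split=> [/existsP[e /eqP E]|[h /halfE[a' [b' [-> -> ab]]] []]]; last first.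
    by move=> /code_inj <- /code_inj <-.
  have ltM := code_lt e; rewrite ends_low in E; case: (set2_eqP E) => -[<- <-].
    by exists (code e); first by lia.
  by exists (#|edge G'| + code e); first by lia.
- by move=> h /halfE[a [_ [? _ _]]]; exists a.
(* The first conjunct identifies the number that the program writes with the code of the node below
   [e]; the second is the specification of [prev]. *)
have /fin_all_exists[prev prevE] (e : edge G') : exists o : option (edge G'),
    (if chain (s0 8) (code e) (s0 8 (code e)) is i :: _ then #|vertex T| + i
     else s0 5 (s0 8 (code e) + s0 8 (code e))) =
    code (if o is Some x then inr x else inl (gsrc (fE f e)) : vertex T + edge G') /\
    if o is Some p then
      [/\ fE f p = fE f e, code p < code e &
        forall q, fE f q = fE f e -> code q < code e -> code q <= code p]
    else forall q, fE f q = fE f e -> code e <= code q.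
  have := chain_head (s0 8) (code e) (s0 8 (code e)).
  case: (chain _ _ _) => [|i l].
    move=> none; exists None; rewrite code_inl e8 (e5 _).1; split=> // x fx.
    by rewrite leqNgt; apply/negP => /none; rewrite !e8 fx.
  case=> lti Ki maxi; have [|x Ex] := @codeP (edge G') i.
    by apply: leq_trans lti _; apply: ltnW; apply: code_lt.
  exists (Some x); rewrite code_inr Ex; split=> //; split=> //.
    by apply: code_inj; rewrite -!e8 Ex.
  by move=> y fy lty; apply: maxi => //; rewrite !e8 fy.
have /fin_all_exists[top topE] (g : edge T) : exists t : edge G',
    head 0 (chain (s0 8) #|edge G'| (code g)) = code t /\
    (fE f t = g /\ forall q, fE f q = g -> code q <= code t).
  have := chain_head (s0 8) #|edge G'| (code g).
  have [x fx] := edge_fiber_neq0 degf g.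
  case: (chain _ _ _) => [|i l].
    by move=> /(_ (code x) (code_lt x)); rewrite e8 fx.
  case=> /codeP[y <-] Ky maxy; exists y; split=> //; split.
    by apply: code_inj; rewrite -e8.
  by move=> u fu; apply: maxy; rewrite ?code_lt // e8 fu.
pose prevP (e : edge G') := (prevE e).2; pose topP e := (topE e).2.
pose D := @path_tree _ _ f gsrc gtgt (@code (edge G')) prev top prevP.
pose X : vertex D -> {set vertex G} := @bag _ _ f gsrc gtgt glow ghigh _ _ top prevP _ lab.
pose sD (d : edge D) := match d with
  | inl e => [:: code (inr e : vertex D); code (below f gsrc prev e : vertex D)]
  | inr e => [:: code (inr (top e) : vertex D); code (inl (gtgt e) : vertex D)]
  end.
have lsD d : lists (sD d) (ends d).
  have := card_ends d; case: d => [e|e] /=; rewrite cards2; case: eqP => // /eqP ne _;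
    exact: lists_pair.
pose sB (d : vertex D) := map predn (match d with
  | inl w => vertex_labels #|vertex G'| (s0 7) L (code w)
  | inr e => edge_labels #|edge G'| (s0 8) src tgt L (code e)
  end).
have lsB d : lists (sB d) (X d).
  case: d => [w|e]; apply: lists_bag_labels => // j.
    rewrite -[flatten _]/(flatten [seq [:: i] | i <- _]) flatten_seq1 mem_chain.
    split=> [/andP[/codeP[x <-]]|[x]].
      by rewrite e7 (inj_eq (@code_inj _)) => fx; exists x; rewrite // inE.
    by rewrite inE => /eqP fx ->; rewrite code_lt e7 fx eqxx.
  split.
    case/flattenP=> _ /mapP[i + ->]; rewrite mem_chain => /andP[/codeP[x <-]].
    rewrite !e8 (inj_eq (@code_inj _)) => fx; rewrite mem_edge_emits srcE tgtE.
    case/orP=> /andP[le /eqP->].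
      by exists (glow x); rewrite // inE; apply/orP; left; apply: imset_f; rewrite inE fx.
    by exists (ghigh x); rewrite // inE; apply/orP; right; apply: imset_f; rewrite inE fx.
  case=> y yB ->; move: yB; rewrite inE.
  move=> /orP[] /imsetP[x + ->]; rewrite inE => /andP[/eqP fx le].
    apply/flattenP; exists (edge_emits src tgt (code e) (code x)).
      by apply: map_f; rewrite mem_chain code_lt !e8 fx eqxx.
    by rewrite mem_edge_emits srcE eqxx le.
  apply/flattenP; exists (edge_emits src tgt (code e) (code x)).
    by apply: map_f; rewrite mem_chain code_lt !e8 fx eqxx.
  by rewrite mem_edge_emits tgtE eqxx le orbT.
exists s, t, D, X,
  ([:: [:: #|vertex D|; #|edge D|];
     flatten [seq sD d | d <- enum (edge D)]] ++
  [:: flatten [seq size (sB i) :: sB i | i <- enum (vertex D)]]); split=> //.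
- split.
    apply: (bag_tree_decomposition ends_src ends_low _ _ (@code_inj _)
      prevP topP vlab.1 vlab.2 _ tT).
    + by move=> e; have [] := fVp e.
    + by move=> e; have [] := fVp e.
    + exact: refinement_label_edge vlab.
  apply: bag_width; first exact: code_inj.
    exact: card_vertex_fiber.
  exact: card_edge_fiber.
split.
  exists [:: [:: #|vertex D|; #|edge D|]; flatten [seq sD d | d <- enum (edge D)]], sB.
  by split=> //; exists sD.
case=> [|[|[|a]]] i /=.
- have -> : #|vertex D| = #|vertex T| + #|edge G'| by exact: card_sum.
  have -> : #|edge D| = #|edge G'| + #|edge T| by exact: card_sum.
  by case: i => [|[|i]].
- have all2 : all (fun s => size s == 2) [seq sD d | d <- enum (edge D)].
    by apply/allP => _ /mapP[d _ ->]; rewrite /sD; case: d.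
  have szD : size (flatten [seq sD d | d <- enum (edge D)]) = #|edge D| + #|edge D|.
    by rewrite size_flatten2 // size_map -cardE.
  rewrite szD => lti; have [|d Ed] := @codeP (edge D) i./2; first by lia.
  have Ei : i = code d + code d + 0 \/ i = code d + code d + 1 by lia.
  have nE j : j < 2 -> nth 0 (flatten [seq sD d | d <- enum (edge D)]) (code d + code d + j)
      = nth 0 (sD d) j by move=> ltj; rewrite nth_flatten2 // nth_enum_code.
  have [edE edT] := edgs.
  have [sd0 sd1] : s 1 (code d + code d) = nth 0 (sD d) 0 /\
      s 1 (code d + code d + 1) = nth 0 (sD d) 1.
    case: (d) => [e|e]; rewrite ?code_inl ?code_inr /=.
      have [-> ->] := edE _ (code_lt e); rewrite code_inr; split=> //.
      exact: (prevE e).1.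
    have [-> ->] := edT _ (code_lt e); rewrite code_inr code_inl (topE e).1.
    by rewrite (e5 e).2.
  by case: Ei => ->; rewrite nE // ?addn0.
- suff -> : flatten [seq size (sB i) :: sB i | i <- enum (vertex D)] =
      bags_code #|edge G'| #|vertex G'| (s0 7) (s0 8) src tgt L #|vertex T| by exact: bgs.
  rewrite enum_sum map_cat /bags_code -!map_enum_code.
  by congr (flatten (_ ++ _)); rewrite -[LHS]map_comp; apply: eq_map => x /=;
    rewrite /bag_code /sB size_map.
- by rewrite nth_nil.
Qed.

(** * From a decomposition to the treewidth *)

Lemma instance_coded (G G' T : mgraph) (phi : vertex G -> vertex G')
    (f : finite_morphism G' T) : exists input, codes_instance phi f input.
Proof.
pose w (H : mgraph) := [:: [:: #|vertex H|; #|edge H|];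
  flatten [seq [seq code x | x <- enum (ends e)] | e <- enum (edge H)]].
have wP H : codes_graph H (w H).
  by exists (fun e => [seq code x | x <- enum (ends e)]) => // e; apply: perm_refl.
by eexists; exists (w G), (w G'), (w T).
Qed.

(** Decompositions range over trees of any size, so whether a narrower one exists is settled by
    excluded middle; the descent stops because widths are natural numbers. *)
Lemma treewidth_exists (G : mgraph) (T : mgraph) (X : vertex T -> {set vertex G}) :
  tree_decomposition X -> exists2 w, has_treewidth G w & w <= width X.
Proof.
have [n] := ubnP (width X); elim: n T X => // n IH T X ltn tdX.
case: (classic (exists (T' : mgraph) (X' : vertex T' -> {set vertex G}),
    tree_decomposition X' /\ width X' < width X)) => [[T' [X' [td' lt']]]|min].
  have [|w tw lew] := IH T' X' _ td'; first by lia.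
  by exists w => //; lia.
exists (width X) => //; split; first by exists T, X.
move=> T' X' td'; rewrite leqNgt; apply/negP => lt'.
by apply: min; exists T', X'.
Qed.

Theorem theorem3 :
  (forall (G : mgraph) (k : nat),
     connected G -> has_stable_gonality G k ->
     exists2 w : nat, has_treewidth G w & w <= k) /\
  (exists (p : program) (C : nat),
     forall (G G' T : mgraph) (phi : vertex G -> vertex G')
       (f : finite_morphism G' T) (k : nat) (input : seq (seq nat)),
       connected G -> refinement phi -> is_tree T -> harmonic_of_degree f k ->
       codes_instance phi f input ->
       exists (s : store) (t : nat) (D : mgraph)
         (X : vertex D -> {set vertex G}) (output : seq (seq nat)),
         [/\ exec p (load input) s t,
             t <= C * (k ^ 2 * #|vertex G'|),
             tree_decomposition X /\ width X <= k &
             codes_tree_decomposition X output /\ holds s output]).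
Proof.
split; last first.
  by exists decompose, 3000 => G G' T phi f k input; apply: decompose_correct.
move=> G k cG [[G' [T [phi [f [refi tT degf]]]]] _].
have [input codes] := instance_coded phi f.
have [s [t [D [X [_ [_ _ [tdX leX] _]]]]]] := decompose_correct cG refi tT degf codes.
by have [w tw lew] := treewidth_exists tdX; exists w => //; apply: leq_trans leX.
Qed.
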